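(* Let $\Gamma := \mathrm{SL}_2(\mathbb{Z}[1/2])$, and let $\widetilde\Gamma$ be the preimage of $\Gamma\subset \mathrm{SL}_2(\mathbb{R})$ under the universal covering homomorphism $\widetilde{\mathrm{SL}}_2(\mathbb{R})\to\mathrm{SL}_2(\mathbb{R})$. Then: (1) $\widetilde\Gamma$ is finitely presented; (2) $H_1(\widetilde\Gamma;\mathbb{Z})$ is finite; (3) $H_2(\widetilde\Gamma;\mathbb{R})\cong 0$.
   Context: $\widetilde\Gamma$ is the central extension of $\Gamma$ by $\mathbb{Z}$ corresponding to the integral Euler class of $\Gamma$. *)

(* Defs.v *)
From HB Require Import structures.
From mathcomp Require Import all_boot all_order all_algebra.
From mathcomp Require Import boolp classical_sets reals topology normedtype trigo.
From Stdlib Require Import Relation_Operators.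
From Stdlib Require List.
Set Implicit Arguments. Unset Strict Implicit. Unset Printing Implicit Defensive.
Import Order.TTheory GRing.Theory Num.Theory.
Import numFieldNormedType.Exports.
Local Open Scope ring_scope.

(* Generic setting: a "group" given as a subset S of a carrier T equipped    *)
(* with a multiplication, unit and inverse (closed on S).                    *)
Section Generic.
Variables (T : Type) (mul : T -> T -> T) (one : T) (inv : T -> T) (S : T -> Prop).

(* words in generators: (index, inverted?) *)
Definition word := seq (nat * bool).

Definition eval_word (gens : seq T) (w : word) : T :=
  foldr (fun ib acc => mul (if ib.2 then inv (nth one gens ib.1)
                            else nth one gens ib.1) acc) one w.

(* one step of the congruence on words generated by free reduction and    *)
(* relators; its reflexive-symmetric-transitive closure identifies the     *)
(* words that are equal in the presented group <gens | rels>.              *)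
Inductive pres_step (rels : seq word) : word -> word -> Prop :=
| pres_red u v i b : pres_step rels (u ++ (i, b) :: (i, ~~ b) :: v) (u ++ v)
| pres_rel u v r : r \in rels -> pres_step rels (u ++ r ++ v) (u ++ v).

Definition pres_equiv rels := clos_refl_sym_trans word (pres_step rels).

Definition word_in (n : nat) (w : word) := all (fun ib => ib.1 < n)%N w.

(* S is finitely presented: finitely many generators gens in S and        *)
(* finitely many relators rels such that the natural map                  *)
(* <gens | rels> -> S is an isomorphism.                                   *)
Definition finitely_presented : Prop :=
  exists (gens : seq T) (rels : seq word),
    (forall g, List.In g gens -> S g) /\
    all (word_in (size gens)) rels /\
    (forall g, S g -> exists w, word_in (size gens) w /\ eval_word gens w = g) /\
    (forall w, word_in (size gens) w ->
       (eval_word gens w = one <-> pres_equiv rels w [::])).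

(* ---- Group homology with trivial coefficients, inhomogeneous bar complex *)
(* An n-chain with coefficients in K is a finite formal K-combination of    *)
(* n-tuples [g1|...|gn] of elements of S, represented by a list.           *)
Variable K : pzRingType.

Definition chain := seq (K * seq T).

Definition is_chain (n : nat) (c : chain) : Prop :=
  forall p, List.In p c -> size p.2 = n /\ (forall g, List.In g p.2 -> S g).

Definition coeff (c : chain) (x : seq T) : K :=
  \sum_(p <- c | `[< p.2 = x >]) p.1.

Definition chain_eq (c d : chain) : Prop := forall x, coeff c x = coeff d x.

Definition bd2_term (p : K * seq T) : chain :=
  match p.2 with
  | [:: g; h] => [:: (p.1, [:: h]); (- p.1, [:: mul g h]); (p.1, [:: g])]
  | _ => [::]
  end.
Definition bd2 (c : chain) : chain := flatten (map bd2_term c).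

Definition bd3_term (p : K * seq T) : chain :=
  match p.2 with
  | [:: g; h; k] => [:: (p.1, [:: h; k]); (- p.1, [:: mul g h; k]);
                        (p.1, [:: g; mul h k]); (- p.1, [:: g; h])]
  | _ => [::]
  end.
Definition bd3 (c : chain) : chain := flatten (map bd3_term c).

(* H_1(S;K) = C_1 / im d_2 (since d_1 = 0) is finite *)
Definition H1_finite : Prop :=
  exists L : seq chain,
    (forall e, List.In e L -> is_chain 1 e) /\
    forall c, is_chain 1 c ->
      exists e d, List.In e L /\ is_chain 2 d /\ chain_eq c (e ++ bd2 d).

Definition H2_zero : Prop :=
  forall c, is_chain 2 c -> chain_eq (bd2 c) [::] ->
    exists d, is_chain 3 d /\ chain_eq (bd3 d) c.

End Generic.

(* The universal cover of SL_2(R), modelled as the group of pairs (A, f)    *)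
(* with A in SL_2(R) and f : R -> R a continuous lift of the action of A on *)
(* the circle of rays of R^2 (angle t |-> angle of A (cos t, sin t)).       *)
(* The inverse homeomorphism f' of f is carried along to make inversion     *)
(* explicit.  Multiplication is (A,f)(B,g) = (AB, f o g).                   *)
Section Cover.
Variable R : realType.

Definition cov := ('M[R]_2 * ((R -> R) * (R -> R)))%type.

Definition cov_mul (x y : cov) : cov :=
  (x.1 *m y.1, (x.2.1 \o y.2.1, y.2.2 \o x.2.2)).
Definition cov_one : cov := (1%:M, (id, id)).
Definition cov_inv (x : cov) : cov := (invmx x.1, (x.2.2, x.2.1)).

Definition lifts (A : 'M[R]_2) (f : R -> R) : Prop :=
  forall t : R, exists r : R, 0 < r /\
    A ord0 ord0 * cos t + A ord0 ord_max * sin t = r * cos (f t) /\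
    A ord_max ord0 * cos t + A ord_max ord_max * sin t = r * sin (f t).

Definition in_cover (x : cov) : Prop :=
  \det x.1 = 1 /\ continuous (x.2.1 : R -> R) /\
  cancel x.2.1 x.2.2 /\ cancel x.2.2 x.2.1 /\ lifts x.1 x.2.1.

Definition dyadic (a : R) : Prop :=
  exists (m : int) (k : nat), a = m%:~R / 2 ^+ k.

Definition Gamma_tilde (x : cov) : Prop :=
  in_cover x /\ forall i j, dyadic (x.1 i j).

End Cover.

(* Main.v *)
(** Put w = [[0,-1],[1,0]], t = [[1,1],[0,1]] and let s be the conjugate of w by
    diag(sqrt 2, 1/sqrt 2), lifted to the universal cover so that w turns by a
    right angle and t fixes the horizontal axis. The claim is that
      < w, t, s | (wt)^3 = w^2, (s t^2)^3 = s^2, w t w^-1 = s t^4 s^-1 >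
    presents the preimage of SL_2(Z[1/2]). In the presented group z = w^2 = s^2 is
    central and u = s w^-1 maps to diag(2, 1/2), so z, t, u span a copy of the
    triangular subgroup. Euclid's algorithm in Z[1/2], with the odd part as norm,
    writes each matrix as a product b0 w b1 w ... with triangular b_i. The quotients
    possible at one step are linked by changes by plus or minus 2^k, and such a
    change is realised by one of the first two relations; hence the product
    depends, up to powers of z, only on the matrix. As z^i is a rotation by i pi, the
    presented group injects into the cover.

    The presentation has as many relators as generators, with exponent matrix of
    determinant 3. So H_1 is generated by t with 3 t = 0, and every central extension
    by a real vector space splits: the lifts of the generators can be corrected to
    satisfy the relators. Applied to the tautological extension by C_2 / B_2 this
    says that every 2-cycle is a boundary. *)
Require Import Defs.
From HB Require Import structures.
From mathcomp Require Import all_boot all_order all_algebra.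
From mathcomp Require Import generic_quotient.
From mathcomp Require Import boolp classical_sets reals topology normedtype realfun.
From mathcomp Require Import trigo.
From mathcomp Require Import zify ring lra.
From Stdlib Require Import Relation_Operators.
Set Implicit Arguments. Unset Strict Implicit. Unset Printing Implicit Defensive.
Import Order.TTheory GRing.Theory Num.Theory.
Import numFieldNormedType.Exports.
Local Open Scope ring_scope.

(** * Arithmetic of Z[1/2] and its Euclidean norm *)

Section DyadicArithmetic.
Variable R : realType.
Implicit Types (a b c x : R) (m n k : int).

(** The relators reflect the decomposition of SL_2(Z[1/2]) as an amalgam of SL_2(Z) and its
    conjugate by diag(sqrt 2, 1/sqrt 2): conjugation by that matrix sends w to s and t to t^2, so
    the second relator is the conjugate of the first, and the third compares two descriptions of one
    lower unipotent matrix. That the two centres agree, s^2 = w^2, is derived from the three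
    relators, which keeps the presentation balanced. The obstacle in the word problem is that the
    units of Z[1/2] are plus or minus 2^k, so a division that is not exact has infinitely many
    remainders of smaller odd part, one for each power of 2. No normal form is chosen. Any two
    Euclidean expansions of the same matrix are compared instead, by induction on the odd part of
    the lower-left entry. The same comparison shows that left multiplication by w preserves the
    elements that have an expansion, so every element of the presented group has one. *)

Lemma two_neq0 : (2 : R) != 0.
Proof. by rewrite pnatr_eq0. Qed.

Lemma expz2_neq0 k : (2 : R) ^ k != 0.
Proof. exact: expfz_neq0 two_neq0. Qed.

Lemma expz2D j k : (2 : R) ^ (j + k) = 2 ^ j * 2 ^ k.
Proof. exact: expfzDr two_neq0. Qed.

Lemma odd_absz_pow2_eq m n k l : odd `|m| -> odd `|n| ->
  m%:~R * 2 ^ k = n%:~R * 2 ^ l :> R -> m = n /\ k = l.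
Proof.
wlog lekl : m n k l / k <= l.
  move=> H om on E; case/orP: (le_total k l) => kl; first exact: H.
  by case: (H n m l k kl on om (esym E)) => -> ->.
move=> om on.
have [d ->] : exists d : nat, l = k + d%:Z.
  by exists `|l - k|%N; lia.
rewrite expz2D => E.
have {}E : m = n * 2 ^ d%:Z.
  apply: (intr_inj (R := R)); apply: (mulIf (expz2_neq0 k)).
  by rewrite E intrM mulrCA mulrC -!mulrA -exprz_pintl // mulrC mulrA.
case: d E => [|d] E; first by split; rewrite ?addr0 // E expr0z mulr1.
move: om; rewrite E abszM.
by rewrite exprSz abszM mulnCA oddM.
Qed.

Lemma int_two_adic m : m != 0 -> exists n (d : nat), odd `|n| /\ m = n * 2 ^+ d.
Proof.
move=> m0; have : (0 < `|m|)%N by rewrite absz_gt0.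
case/(pfactor_coprime (isT : prime 2)) => n cn En.
exists (sgz m * n%:Z), (logn 2 `|m|).
rewrite abszM absz_sg m0 mul1n absz_nat -coprime2n cn; split=> //.
by rewrite {1}(intEsg m) -mulrA {1}En PoszM -(natz (2 ^ _)%N) natrX.
Qed.

Definition is_odd_part c (N : nat) :=
  (c = 0 /\ N = 0%N) \/
  exists m k, [/\ odd `|m|, c = m%:~R * 2 ^ k & N = `|m|%N].

(** The index of the ideal generated by [c] in Z[1/2], for [c] nonzero. It is chosen by [xget]
    because the argument is an arbitrary real; the value is 0 at 0 and outside Z[1/2]. *)
Definition odd_part c : nat := xget 0%N [set N | is_odd_part c N].

Lemma odd_partE m k : odd `|m| -> odd_part (m%:~R * 2 ^ k : R) = `|m|%N.
Proof.
move=> om; apply: xget_unique => [|N [[E _]|[n [l [on E ->]]]]].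
- by right; exists m, k.
- move/eqP: E; rewrite mulf_eq0 (negPf (expz2_neq0 k)) orbF intr_eq0 => /eqP E.
  by move: om; rewrite E.
- by case: (odd_absz_pow2_eq om on E) => ->.
Qed.

Lemma odd_part1 : odd_part 1 = 1%N.
Proof. by have := @odd_partE 1 0 isT; rewrite mulr1. Qed.

Lemma odd_part0 : odd_part 0 = 0%N.
Proof.
apply: xget_unique => [|N [[_ ->]//|[m [k [om E ->]]]]]; first by left.
move/esym/eqP: E; rewrite mulf_eq0 (negPf (expz2_neq0 k)) orbF intr_eq0 => /eqP E.
by move: om; rewrite E.
Qed.

Lemma dyadicP c : dyadic c <-> exists m k, c = m%:~R * 2 ^ k.
Proof.
split=> [[m [k ->]]|[m [[k|k] ->]]].
- by exists m, (- k%:Z); rewrite -exprnN.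
- by exists (m * 2 ^+ k), 0%N; rewrite expr0 divr1 intrM rmorphXn.
- by exists m, k.+1.
Qed.

Lemma dyadic_odd c : dyadic c -> c <> 0 ->
  exists m k, odd `|m| /\ c = m%:~R * 2 ^ k.
Proof.
case/dyadicP=> m [k ->] c0.
have m0 : m != 0 by apply/eqP => m0; apply: c0; rewrite m0 mul0r.
have [n [d [on ->]]] := int_two_adic m0.
exists n, (d%:Z + k); split=> //.
by rewrite expz2D intrM rmorphXn mulrA.
Qed.

Lemma odd_part_eq0 c : dyadic c -> odd_part c = 0%N -> c = 0.
Proof.
move=> dc; case: (pselect (c = 0)) => // c0.
have [m [k [om ->]]] := dyadic_odd dc c0.
by rewrite odd_partE // => E; move: om; rewrite E.
Qed.

Lemma dyadic0 : dyadic (0 : R).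
Proof. by exists 0, 0%N; rewrite mul0r. Qed.

Lemma dyadic_pow2 k : dyadic ((2 : R) ^ k).
Proof. by apply/dyadicP; exists 1, k; rewrite mul1r. Qed.

Lemma dyadic_int m : dyadic (m%:~R : R).
Proof. by exists m, 0%N; rewrite divr1. Qed.

Lemma dyadicN c : dyadic c -> dyadic (- c).
Proof. by case=> m [k ->]; exists (- m), k; rewrite rmorphN mulNr. Qed.

Lemma dyadicM a b : dyadic a -> dyadic b -> dyadic (a * b).
Proof.
move=> /dyadicP [m [k ->]] /dyadicP [n [l ->]]; apply/dyadicP.
by exists (m * n), (k + l); rewrite intrM expz2D mulrACA.
Qed.

Lemma dyadicD a b : dyadic a -> dyadic b -> dyadic (a + b).
Proof.
move=> [m [k ->]] [n [l ->]]; exists (m * 2 ^+ l + n * 2 ^+ k), (k + l)%N.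
rewrite rmorphD /= !intrM !rmorphXn /= exprD.
by field; rewrite !expf_neq0 ?two_neq0.
Qed.

Lemma odd_partN c : odd_part (- c) = odd_part c.
Proof.
congr xget; apply/seteqP; split=> N /= [[E ->]|[m [k [om E ->]]]].
- by left; rewrite -(opprK c) E oppr0.
- by right; exists (- m), k; rewrite abszN om rmorphN mulNr -E opprK.
- by left; rewrite E oppr0.
- by right; exists (- m), k; rewrite abszN om rmorphN mulNr -E.
Qed.

Lemma odd_partM2 c k : dyadic c -> odd_part (c * 2 ^ k) = odd_part c.
Proof.
move=> dc; case: (pselect (c = 0)) => [->|c0]; first by rewrite mul0r.
have [m [l [om ->]]] := dyadic_odd dc c0.
by rewrite -mulrA -expz2D !odd_partE.
Qed.

Lemma odd_part_int_le m k : (odd_part (m%:~R * 2 ^ k : R) <= `|m|)%N.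
Proof.
have [->|m0] := eqVneq m 0; first by rewrite mul0r odd_part0.
have [n [d [on ->]]] := int_two_adic m0.
rewrite intrM rmorphXn -[_ ^+ d]/(_ ^ d%:Z) -mulrA -expz2D odd_partE // abszM.
by rewrite leq_pmulr // abszX expn_gt0.
Qed.

(** Up to powers of 2 this is integer division by the odd part [n] of [c]: the remainder is [m]
    modulo [n] times a power of 2, and extracting its odd part can only make it smaller. *)
Lemma dyadic_division a c : dyadic a -> dyadic c -> c <> 0 ->
  exists2 x, dyadic x & (odd_part (a + x * c) < odd_part c)%N.
Proof.
move=> /dyadicP [m [k ->]] dc c0; have [n [l [on ->]]] := dyadic_odd dc c0.
have n0 : n != 0 by apply/eqP => n0; move: on; rewrite n0.
exists (- (m %/ n)%Z%:~R * 2 ^ (k - l)).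
  exact: dyadicM (dyadicN (dyadic_int _)) (dyadic_pow2 _).
rewrite odd_partE //.
have -> : m%:~R * 2 ^ k + - (m %/ n)%Z%:~R * 2 ^ (k - l) * (n%:~R * 2 ^ l) =
          (m %% n)%Z%:~R * 2 ^ k :> R.
  rewrite [in X in X%:~R * _ + _](divz_eq m n) rmorphD /= intrM mulrDl.
  rewrite -[_ * _ * (n%:~R * _)]mulrA (mulrC (2 ^ (k - l))) -(mulrA n%:~R).
  by rewrite -expz2D subrKC; ring.
apply: leq_ltn_trans (odd_part_int_le _ _) _.
by have := ltz_mod m n0; have := modz_ge0 m n0; lia.
Qed.

(** An odd factor [n] cannot cancel a denominator that is a power of 2. *)
Lemma odd_dvd_dyadic (n m : int) x : odd `|n| -> dyadic x ->
  x * n%:~R = m%:~R -> exists q : int, x = q%:~R.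
Proof.
move=> on dx; case: (pselect (x = 0)) => [->|x0 E]; first by exists 0.
have [p [k [op Ex]]] := dyadic_odd dx x0.
have m0 : m != 0.
  apply/eqP => m0; move: E; rewrite m0 => /eqP; rewrite mulf_eq0 intr_eq0.
  by case/orP => /eqP // n0; move: on; rewrite n0.
have [q [d [oq Em]]] := int_two_adic m0.
move: E; rewrite Ex Em mulrAC -intrM (intrM _ q) rmorphXn -[_ ^+ d]/(_ ^ d%:Z).
case/odd_absz_pow2_eq=> //; first by rewrite abszM oddM op.
by move=> _ ->; exists (p * 2 ^+ d); rewrite intrM rmorphXn.
Qed.

Lemma dyadic_unit a b : dyadic a -> dyadic b -> a * b = 1 ->
  exists (e : bool) k, a = (-1) ^+ e * 2 ^ k.
Proof.
move=> da db E.
have a0 : a <> 0 by move=> a0; move/eqP: E; rewrite a0 mul0r eq_sym oner_eq0.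
have b0 : b <> 0 by move=> b0; move/eqP: E; rewrite b0 mulr0 eq_sym oner_eq0.
have [m [k [om Ea]]] := dyadic_odd da a0.
have [n [l [on Eb]]] := dyadic_odd db b0.
move: E; rewrite Ea Eb mulrACA -expz2D -intrM => E.
have /odd_absz_pow2_eq [] : (m * n)%:~R * 2 ^ (k + l) = 1%:~R * 2 ^ 0 :> R.
- by rewrite E mulr1.
- by rewrite abszM oddM om.
- by [].
move=> mn _; exists (m == -1), k; congr (_ * _).
have : m = 1 \/ m = -1 by nia.
by case=> ->; rewrite ?expr0 ?expr1.
Qed.

End DyadicArithmetic.

(** * Integer powers in a group *)

Section IntegerPowers.
Local Open Scope group_scope.
Variable G : groupType.
Implicit Types (x y : G) (m n : int).

Definition zpow x n : G :=
  match n with Posz k => x ^+ k | Negz k => x ^- k.+1 end.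

Lemma zpow0 x : zpow x 0 = 1. Proof. by []. Qed.

Lemma zpow1 x : zpow x 1 = x. Proof. by []. Qed.

Lemma zpowS x n : zpow x (1 + n)%R = x * zpow x n.
Proof.
case: n => k; first by rewrite /zpow -PoszD add1n expgS.
rewrite [zpow x (Negz k)]/= expgSr invgM mulVKg.
case: k => [|k]; first by rewrite expg0 invg1.
by have -> : (1 + Negz k.+1)%R = Negz k by lia.
Qed.

Lemma zpowD x m n : zpow x (m + n)%R = zpow x m * zpow x n.
Proof.
case: m => k.
  elim: k => [|k IH]; first by rewrite add0r mul1g.
  by rewrite -add1n PoszD -addrA !zpowS IH mulgA.
elim: k => [|k IH].
  apply: (mulgI x); rewrite -zpowS mulgA -zpowS.
  by rewrite addrA subrr add0r mul1g.
apply: (mulgI x); rewrite -zpowS mulgA -zpowS !addrA.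
by have -> : (1 + Negz k.+1)%R = Negz k by lia.
Qed.

Lemma zpowN x n : zpow x (- n)%R = (zpow x n)^-1.
Proof. by apply/esym/mulg1_eq; rewrite -zpowD subrr. Qed.

Lemma zpow_commute x y n : commute x y -> commute (zpow x n) y.
Proof.
move=> cxy; apply: commute_sym; case: n => k /=.
  exact/commuteX/commute_sym.
exact/commuteV/commuteX/commute_sym.
Qed.

Lemma zpow_conj x y n : zpow (y * x * y^-1) n = y * zpow x n * y^-1.
Proof.
have E k : (y * x * y^-1) ^+ k = y * x ^+ k * y^-1.
  have := conjXg x y^-1 k; rewrite /conjg !invgK !mulgA; exact: esym.
by case: n => k /=; rewrite E // !invgM invgK mulgA.
Qed.

(** Serves with [r = 4] for [u] acting on [t], and with [r = -1] for [w] acting on [u]. *)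
Lemma zpow_intertwine x y r n : y * x = zpow x r * y ->
  y * zpow x n = zpow x (r * n)%R * y.
Proof.
move=> E; have {}E : y * x * y^-1 = zpow x r by rewrite E mulgK.
apply: (mulIg y^-1); rewrite -zpow_conj mulgK E.
case: n => k.
  elim: k => [|k IH]; first by rewrite mulr0.
  by rewrite -add1n PoszD zpowS IH mulrDr mulr1 zpowD.
have -> : Negz k = (- k.+1%:Z)%R by [].
rewrite zpowN mulrN zpowN; congr (_^-1).
elim: k => [|k IH]; first by rewrite mulr1.
by rewrite -add1n PoszD zpowS IH mulrDr mulr1 zpowD.
Qed.

End IntegerPowers.

(** * Consequences of the three relators in an arbitrary group *)

Section GroupRelations.
Local Open Scope group_scope.

(** The hypothesis is the relation of the braid group on three strands: [y] and its conjugate by [x]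
    satisfy the braid relation, with the half twist [x^-1] as common value, and [x ^+ 2] is central.
    The second conclusion is the form in which a product of two rotations collapses to one. *)
Lemma half_twist (G : groupType) (x y : G) : (x * y) ^+ 3 = x ^+ 2 ->
  [/\ commute (x ^+ 2) y, x * y * x = y^-1 * x * y^-1,
      y * (x * y * x^-1) * y = x^-1 & (x * y * x^-1) * y * (x * y * x^-1) = x^-1].
Proof.
move=> E.
have cy : commute (x ^+ 2) y.
  have -> : y = x^-1 * (x * y) by rewrite mulKg.
  apply: commuteM; first exact/commuteV/commute_sym/commuteX/commute_refl.
  by rewrite -E; apply/commute_sym/commuteX/commute_refl.
have E1 : y * x * y * x * y = x.
  by apply: (mulgI x); rewrite -expg2 -E !expgS expg0 mulg1 !mulgA.
have xV : x^-1 = x * (x ^+ 2)^-1 by rewrite expg2 invgM mulgA mulgV mul1g.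
have cyV : commute y (x ^+ 2)^-1 by apply/commuteV/commute_sym.
have yb : y * (x * y * x^-1) * y = x^-1.
  have -> : y * (x * y * x^-1) * y = (y * x * y * x * y) * (x ^+ 2)^-1.
    by rewrite {1}xV -!mulgA; do 4![congr (_ * _)]; rewrite cyV.
  by rewrite E1 xV.
split=> //.
- by apply: (mulgI y); apply: (mulIg y); rewrite !mulgA mulgV mul1g mulgVK.
- have yx : y = x * (x * y * x^-1) * x^-1.
    have -> : x * (x * y * x^-1) * x^-1 = x ^+ 2 * y * x^-1 * x^-1.
      by rewrite expg2 !mulgA.
    by rewrite cy expg2 !mulgA !mulgK.
  rewrite {2}yx; move: (yb); set b := x * y * x^-1 => {}yb.
  have -> : b * (x * b * x^-1) * b = x * (y * b * y) * x^-1.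
    by rewrite /b !mulgA !mulgVK.
  by rewrite yb mulgV mul1g.
Qed.

Variables (G : groupType) (w t s : G).
Hypothesis wt3 : (w * t) ^+ 3 = w ^+ 2.
Hypothesis st3 : (s * t ^+ 2) ^+ 3 = s ^+ 2.
Hypothesis wst : w * t * w^-1 = s * t ^+ 4 * s^-1.

Lemma sqr_s_w : s ^+ 2 = w ^+ 2.
Proof.
have [cwt _ tbt btb] := half_twist wt3.
have [csT _ TcT cTc] := half_twist st3.
move: tbt btb TcT cTc.
set b := w * t * w^-1; set c := s * t ^+ 2 * s^-1 => tbt btb TcT cTc.
have bc : b = c * c.
  by rewrite /b wst /c (expgnDr t 2 2) !mulgA mulgVK.
have csc : commute (s ^+ 2) c.
  apply: commuteM; last exact/commuteV/commute_sym/commuteX/commute_refl.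
  by apply: commuteM => //; apply/commute_sym/commuteX/commute_refl.
clearbody b c.
have sV : (s ^+ 2)^-1 = c * (w ^+ 2)^-1 * c^-1.
  have -> : (s ^+ 2)^-1 = (c * t ^+ 2 * c) * (c * t ^+ 2 * c) by rewrite cTc expg2 invgM.
  have -> : (w ^+ 2)^-1 = (b * t * b) * (b * t * b) by rewrite btb expg2 invgM.
  rewrite expg2.
  have -> : c * (t * t) * c * (c * (t * t) * c) = c * (t * (t * b * t) * t) * c.
    by rewrite bc !mulgA.
  rewrite tbt -btb.
  have -> : t * (b * t * b) * t = (t * b * t) * b * t by rewrite !mulgA.
  by rewrite tbt -btb bc !mulgA mulgK.
apply: invg_inj.
have -> : (w ^+ 2)^-1 = c^-1 * (s ^+ 2)^-1 * c by rewrite sV !mulgA mulVg mul1g mulgVK.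
by rewrite -mulgA -(commuteV (commute_sym csc)) mulKg.
Qed.

Lemma commute_w2 x : x = w \/ x = t \/ x = s -> commute (w ^+ 2) x.
Proof.
have [cwt _ _ _] := half_twist wt3.
case=> [->|[->|->]] //; first exact/commute_sym/commuteX/commute_refl.
by rewrite -sqr_s_w; apply/commute_sym/commuteX/commute_refl.
Qed.

(** Since [w ^+ 2] commutes with [t], also [w^-1 t w = s t^4 s^-1]; a second conjugation by [s] is
    then undone by the centrality of [s ^+ 2]. *)
Lemma scaling_translation : (s * w^-1) * t = t ^+ 4 * (s * w^-1).
Proof.
have czt := commute_w2 (or_intror (or_introl (erefl t))).
have E : w^-1 * t * w = w * t * w^-1.
  apply: (mulgI w); apply: (mulIg w); rewrite !mulgA mulgV mul1g mulgVK.
  by rewrite -(mulgA t w w); apply: esym.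
apply: (mulIg w); apply: (mulIg s^-1).
have -> : s * w^-1 * t * w * s^-1 = s * (w^-1 * t * w) * s^-1 by rewrite !mulgA.
rewrite E wst; have := commuteX 4 czt; rewrite -sqr_s_w.
move: (t ^+ 4) => t4 ct4; apply: (mulIg s); apply: (mulIg s).
by rewrite !mulgA !mulgVK -(mulgA t4 s s); exact: ct4.
Qed.

Lemma rotation_scaling : w * (s * w^-1) = (s * w^-1)^-1 * w.
Proof.
rewrite invgM invgK; apply: (mulIg w); rewrite mulgA mulgVK -mulgA -expg2.
by rewrite -sqr_s_w expg2 !mulgA mulgVK.
Qed.

End GroupRelations.

(** * Matrices of size two by entries *)

Section TwoByTwo.
Variable R : realType.
Implicit Types a b c d : R.

Definition mx2 a b c d : 'M[R]_2 :=
  \matrix_(i, j) if i == ord0 then (if j == ord0 then a else b)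
                 else (if j == ord0 then c else d).

Lemma mx2E a b c d :
  [/\ mx2 a b c d ord0 ord0 = a, mx2 a b c d ord0 ord_max = b,
      mx2 a b c d ord_max ord0 = c & mx2 a b c d ord_max ord_max = d].
Proof. by split; rewrite mxE. Qed.

Lemma mx2_ext (A B : 'M[R]_2) :
  A ord0 ord0 = B ord0 ord0 -> A ord0 ord_max = B ord0 ord_max ->
  A ord_max ord0 = B ord_max ord0 -> A ord_max ord_max = B ord_max ord_max -> A = B.
Proof.
have ordE (i : 'I_2) : i = ord0 \/ i = ord_max.
  by case: i => [[|[|//]] p]; [left|right]; apply: val_inj.
by move=> E1 E2 E3 E4; apply/matrixP => i j; case: (ordE i) => ->; case: (ordE j) => ->.
Qed.

Lemma mx2_eta (A : 'M[R]_2) :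
  A = mx2 (A ord0 ord0) (A ord0 ord_max) (A ord_max ord0) (A ord_max ord_max).
Proof. by apply: mx2_ext; rewrite mxE. Qed.

Lemma mulmx2 (A B : 'M[R]_2) i j :
  (A *m B) i j = A i ord0 * B ord0 j + A i ord_max * B ord_max j.
Proof. by rewrite mxE big_ord_recr big_ord1; congr (A _ _ * B _ _ + _); apply: val_inj. Qed.

Lemma mul_mx2 a b c d a' b' c' d' : mx2 a b c d *m mx2 a' b' c' d' =
  mx2 (a * a' + b * c') (a * b' + b * d') (c * a' + d * c') (c * b' + d * d').
Proof. by apply: mx2_ext; rewrite mulmx2 !mxE. Qed.

Lemma mx2_1 : mx2 1 0 0 1 = 1%:M.
Proof. by apply: mx2_ext; rewrite !mxE. Qed.

Lemma det_mx2E (A : 'M[R]_2) :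
  \det A = A ord0 ord0 * A ord_max ord_max - A ord0 ord_max * A ord_max ord0.
Proof.
rewrite (expand_det_row _ ord0) big_ord_recr big_ord1 /= /cofactor !det_mx11 !mxE.
rewrite expr0 mul1r expr1 mulN1r mulrN.
by congr (A _ _ * A _ _ - A _ _ * A _ _); apply: val_inj.
Qed.

Lemma mx2_inj a b c d a' b' c' d' : mx2 a b c d = mx2 a' b' c' d' ->
  [/\ a = a', b = b', c = c' & d = d'].
Proof.
move=> E; have [e1 e2 e3 e4] := mx2E a b c d.
by split; [rewrite -e1|rewrite -e2|rewrite -e3|rewrite -e4]; rewrite E mxE.
Qed.

End TwoByTwo.

(** * The word problem, in an abstract group with a map to matrices *)

Section WordProblem.
Local Open Scope group_scope.
Variables (R : realType) (G : groupType) (w t u z : G) (phi : G -> 'M[R]_2).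
Hypothesis ww : w * w = z.
Hypothesis zC : forall x, commute z x.
Hypothesis ut : u * t = t ^+ 4 * u.
Hypothesis wu : w * u = u^-1 * w.
Hypothesis wtw : w * t * w = t^-1 * w * t^-1.
Hypothesis wttw : w * t ^+ 2 * w = u^-1 * t ^- 2 * u * w * (t ^- 2 * u).
Hypothesis phi1 : phi 1 = 1%:M.
Hypothesis phiM : forall g h, phi (g * h) = phi g *m phi h.
Hypothesis phiw : phi w = mx2 0 (-1) 1 0.
Hypothesis phit : phi t = mx2 1 1 0 1.
Hypothesis phiu : phi u = mx2 2 0 0 2^-1.

Implicit Types (b g h x y : G) (i k m n p q : int).

Lemma zpow_central i x : zpow z i * x = x * zpow z i.
Proof. exact/zpow_commute/zC. Qed.

Lemma scale_translate_nat (k : nat) n :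
  zpow u k%:Z * zpow t n = zpow t (4 ^+ k * n)%R * zpow u k%:Z.
Proof.
elim: k => [|k IH]; first by rewrite expr0 mul1r zpow0 mulg1 mul1g.
rewrite intS !zpowS -mulgA IH !mulgA; congr (_ * _).
by rewrite (@zpow_intertwine _ t u 4) // exprS mulrA.
Qed.

Lemma rotate_scale n : w * zpow u n = zpow u (- n)%R * w.
Proof. by rewrite -mulN1r; apply: zpow_intertwine. Qed.

Definition central_eq g h := exists i, g = zpow z i * h.

Lemma central_eq_sym g h : central_eq g h -> central_eq h g.
Proof. by case=> i ->; exists (- i)%R; rewrite zpowN mulKg. Qed.

Lemma central_eq_trans g h x : central_eq g h -> central_eq h x -> central_eq g x.
Proof. by case=> i -> [j ->]; exists (i + j)%R; rewrite zpowD mulgA. Qed.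

Lemma central_eq_mull x g h : central_eq g h -> central_eq (x * g) (x * h).
Proof. by case=> i ->; exists i; rewrite !mulgA zpow_central. Qed.

Lemma central_eq_cancel x g h : central_eq (x * g) (x * h) -> central_eq g h.
Proof. by move/(central_eq_mull x^-1); rewrite !mulKg. Qed.

(** Two powers of [u] occur because [t] has integer exponents: [u^-j t^n u^j] stands for the
    translation by n / 4^j. The form is not unique. *)
Definition in_borel b :=
  exists i p n q, b = zpow z i * (zpow u p * zpow t n * zpow u q).

Lemma borel_form p n q : in_borel (zpow u p * zpow t n * zpow u q).
Proof. by exists 0, p, n, q; rewrite mul1g. Qed.

Lemma borel_z i b : in_borel b -> in_borel (zpow z i * b).
Proof. by case=> i' [p [n [q ->]]]; exists (i + i')%R, p, n, q; rewrite zpowD !mulgA. Qed.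

Lemma borel_u p b : in_borel b -> in_borel (zpow u p * b).
Proof.
case=> i' [p' [n [q ->]]]; exists i', (p + p')%R, n, q.
by rewrite mulgA -zpow_central zpowD !mulgA.
Qed.

(** A positive power of [u] passes to the right of [t^n], a negative one to the left of [t^m]; in
    both cases an exponent is multiplied by a power of 4, never divided. *)
Lemma borel_t m b : in_borel b -> in_borel (zpow t m * b).
Proof.
case=> i [p [n [q ->]]]; rewrite mulgA -zpow_central -mulgA.
apply: borel_z; rewrite !mulgA; case: (intP p) => [|k|k].
- by rewrite zpow0 mulg1 -zpowD -[zpow t _]mul1g; exact: (borel_form 0 _ q).
- rewrite -(mulgA (zpow t m)) scale_translate_nat mulgA -zpowD -mulgA -zpowD.
  by rewrite -[zpow t _]mul1g; exact: (borel_form 0).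
- have -> : zpow t m * zpow u (- k.+1%:Z) = zpow u (- k.+1%:Z) * zpow t (4 ^+ k.+1 * m)%R.
    by rewrite zpowN; apply: (mulgI (zpow u k.+1)); rewrite mulgA scale_translate_nat mulgK mulVKg.
  by rewrite -!mulgA (mulgA (zpow t _)) -zpowD mulgA; exact: borel_form.
Qed.

Lemma borelM b b' : in_borel b -> in_borel b' -> in_borel (b * b').
Proof.
move=> [i [p [n [q ->]]]] Bb'; rewrite -!mulgA.
by apply/borel_z/borel_u/borel_t/borel_u.
Qed.

Lemma borel1 : in_borel 1.
Proof. by have := borel_form 0 0 0; rewrite !mulg1. Qed.

Lemma borel_upow p : in_borel (zpow u p).
Proof. by have := borel_u p borel1; rewrite mulg1. Qed.

Lemma borel_zpow p : in_borel (zpow z p).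
Proof. by have := borel_z p borel1; rewrite mulg1. Qed.

Lemma borel_tpow p : in_borel (zpow t p).
Proof. by have := borel_t p borel1; rewrite mulg1. Qed.

Lemma borelV b : in_borel b -> in_borel b^-1.
Proof.
move=> [i [p [n [q ->]]]]; rewrite !invgM -!zpowN -!mulgA.
by apply/borel_u/borel_t/borel_u/borel_zpow.
Qed.

Lemma phi_mulmxI g (A B : 'M[R]_2) : phi g *m A = phi g *m B -> A = B.
Proof.
move=> E; rewrite -(mul1mx A) -(mul1mx B) -phi1 -(mulVg g) phiM -!mulmxA.
by rewrite E.
Qed.

Lemma phi_cancel g h h' : phi (g * h) = phi (g * h') -> phi h = phi h'.
Proof. by rewrite !phiM; exact: phi_mulmxI. Qed.

Lemma phi_zpow x (f : int -> 'M[R]_2) : f 0 = 1%:M ->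
  (forall n, f (1 + n)%R = phi x *m f n) -> forall n, phi (zpow x n) = f n.
Proof.
move=> f0 fS; case=> k.
  by elim: k => [|k IH]; rewrite ?zpow0 ?phi1 ?f0 // intS zpowS phiM IH fS.
elim: k => [|k IH]; apply: (@phi_mulmxI x); rewrite -phiM -zpowS -fS.
  by rewrite subrr zpow0 phi1 f0.
by have -> : (1 + Negz k.+1)%R = Negz k by lia.
Qed.

Lemma phi_z i : phi (zpow z i) = mx2 ((-1) ^ i)%R 0 0 ((-1) ^ i)%R.
Proof.
apply: (phi_zpow (f := fun i => mx2 ((-1) ^ i)%R 0 0 ((-1) ^ i)%R)); first by rewrite mx2_1.
move=> n; rewrite -ww phiM phiw !mul_mx2 expfzDr ?oppr_eq0 ?oner_eq0 // expr1z.
by congr mx2; ring.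
Qed.

Lemma phi_u p : phi (zpow u p) = mx2 (2 ^ p)%R 0 0 (2 ^ (- p))%R.
Proof.
apply: (phi_zpow (f := fun p => mx2 (2 ^ p)%R 0 0 (2 ^ (- p))%R)).
  by rewrite oppr0 mx2_1.
move=> n; rewrite opprD !expz2D phiu mul_mx2.
by congr mx2; rewrite ?expr1z ?exprN1; ring.
Qed.

Lemma phi_t n : phi (zpow t n) = mx2 1 n%:~R 0 1.
Proof.
apply: (phi_zpow (f := fun n => mx2 1 n%:~R 0 1)); first by rewrite mx2_1.
by move=> {}n; rewrite phit mul_mx2 rmorphD /=; congr mx2; ring.
Qed.

Lemma phi_borel i p n q : phi (zpow z i * (zpow u p * zpow t n * zpow u q)) =
  mx2 ((-1) ^ i * 2 ^ (p + q))%R ((-1) ^ i * n%:~R * 2 ^ (p - q))%R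
      0 ((-1) ^ i * 2 ^ (- (p + q)))%R.
Proof.
rewrite !phiM phi_z !phi_u phi_t !mul_mx2 opprD !expz2D.
by congr mx2; ring.
Qed.

Lemma signz i : exists e : bool, ((-1) ^ i = (-1) ^+ e :> R)%R.
Proof.
exists (odd `|i|); case: i => k; rewrite /exprz.
  by rewrite signr_odd.
by rewrite -exprVn invrN1 NegzE abszN signr_odd.
Qed.

Lemma borel_phi b : in_borel b -> exists (e : bool) k (x : R),
  dyadic x /\ phi b = mx2 ((-1) ^+ e * 2 ^ k)%R x 0 ((-1) ^+ e * 2 ^ (- k))%R.
Proof.
move=> [i [p [n [q ->]]]]; rewrite phi_borel; have [e ->] := signz i.
exists e, (p + q)%R, ((-1) ^+ e * n%:~R * 2 ^ (p - q))%R; split=> //.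
apply: dyadicM (dyadic_pow2 _ _); apply: dyadicM; last exact: dyadic_int.
by case: e; rewrite ?expr0 ?expr1; [apply: dyadicN|]; exact: (dyadic_int _ 1).
Qed.

Lemma borel_surj (a x d : R) : dyadic a -> dyadic x -> dyadic d -> (a * d = 1)%R ->
  exists2 b, in_borel b & phi b = mx2 a x 0 d.
Proof.
move=> da dx dd ad; have [e [k Ea]] := dyadic_unit da dd ad.
have Ed : d = ((-1) ^+ e * 2 ^ (- k))%R.
  have a0 : a != 0%R by apply/eqP => a0; move/eqP: ad; rewrite a0 mul0r eq_sym oner_eq0.
  apply: (mulfI a0); rewrite ad Ea mulrACA -expz2D subrr -expr2 sqrr_sign.
  by rewrite mulr1.
have [m [j Ey]] : dyadic ((-1) ^+ e * 2 ^ (- k) * x)%R by rewrite -Ed; apply: dyadicM.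
(* Here [x = a * m / 2^j]. Conjugation by [u^j] divides a translation by 4^j, whence the exponent
   [m * 2^j]. *)
exists (zpow z e%:Z * (zpow u (k - j%:Z)%R * zpow t (m * 2 ^+ j)%R * zpow u j%:Z)).
  by exists e%:Z, (k - j%:Z)%R, (m * 2 ^+ j)%R, j%:Z.
rewrite phi_borel subrK Ea Ed; congr mx2.
have -> : x = ((-1) ^+ e * 2 ^ k * ((-1) ^+ e * 2 ^ (- k) * x))%R.
  rewrite mulrA mulrACA -expz2D subrr -expr2 sqrr_sign mulr1 mul1r //.
rewrite Ey intrM rmorphXn /= !expz2D -!exprnN.
by rewrite -[((-1) ^ e%:Z)%R]/((-1) ^+ e)%R; field; rewrite expf_neq0 ?two_neq0.
Qed.

Lemma borel_phi1 b : in_borel b -> phi b = 1%:M -> central_eq b 1.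
Proof.
move=> [i [p [n [q ->]]]]; rewrite phi_borel -mx2_1 => /mx2_inj [E1 E2 _ _].
have [e Ee] := signz i; rewrite Ee in E1 E2.
have n0 : n = 0.
  apply/eqP; move/eqP: E2; rewrite !mulf_eq0 (negPf (expz2_neq0 _ _)) orbF.
  by rewrite signr_eq0 intr_eq0.
have pq : (p + q = 0)%R.
  have [] := @odd_absz_pow2_eq R ((-1) ^+ e)%R 1 (p + q)%R 0 => //.
  - by case: (e).
  - by rewrite mulr1 rmorphXn rmorphN.
by exists i; rewrite n0 mulg1 -zpowD pq.
Qed.

(** * Collapsing two rotations into one *)

Definition flips b := exists b1 b2,
  [/\ in_borel b1, in_borel b2 & w * b * w = b1 * w * b2].


Lemma flips_scale i p b q : flips b -> flips (zpow z i * (zpow u p * b * zpow u q)).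
Proof.
move=> [c1 [c2 [B1 B2 E]]].
exists (zpow z i * (zpow u (- p) * c1)), (c2 * zpow u (- q)); split.
- exact/borel_z/borel_u.
- exact/borelM/borel_upow.
have Ew : zpow u q * w = w * zpow u (- q) by rewrite rotate_scale opprK.
have -> : zpow z i * (zpow u (- p) * c1) * w * (c2 * zpow u (- q))
  = zpow z i * (zpow u (- p) * (c1 * w * c2) * zpow u (- q)) by rewrite !mulgA.
rewrite -E (mulgA w) -zpow_central -!mulgA Ew; congr (_ * _).
by rewrite !mulgA rotate_scale.
Qed.

Lemma flipsV b : flips b -> flips b^-1.
Proof.
move=> [c1 [c2 [B1 B2 E]]]; exists (z * c2^-1), c1^-1; split.
- exact/(borel_z 1)/borelV.
- exact: borelV.
have wV : w^-1 = zpow z (-1) * w by rewrite zpowN zpow1 -ww invgM mulgVK.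
have zV : z^-1 = zpow z (-1) by [].
apply: invg_inj; rewrite !invgM !invgK zV wV; set Z := zpow z (-1).
have cZ x : Z * x = x * Z by exact: zpow_central.
have -> : Z * w * (b * (Z * w)) = Z * (Z * (w * b * w)).
  by rewrite !mulgA -(cZ (Z * w * b)) !mulgA.
by rewrite E -(cZ c2) -!mulgA (mulgA c1 Z) -(cZ c1) !mulgA -(cZ (Z * c1 * w)) !mulgA.
Qed.

(** Conjugation by [u] multiplies the exponent by 4, so even and odd [d] form two separate chains.
    They start at [t] and [t^2], which is why a braid relation is wanted for each of the two. *)
Lemma flips_pow2 (d : nat) : flips (zpow t (2 ^+ d)).
Proof.
suff [] : flips (zpow t (2 ^+ d)) /\ flips (zpow t (2 ^+ d.+1)) by [].
elim: d => [|d [IH1 IH2]]; last first.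
  split=> //; have := flips_scale 0 1 (-1) IH1.
  rewrite zpow0 mul1g (scale_translate_nat 1) -mulgA -zpowD mulg1.
  by rewrite expr1 !exprS mulrA.
split.
  exists (t^-1), (t^-1); split; [exact: (borel_tpow (-1))|exact: (borel_tpow (-1))|exact: wtw].
exists (u^-1 * t ^- 2 * u), (t ^- 2 * u); split; last exact: wttw.
  by rewrite -mulgA; apply/(borel_u (-1))/(borel_t (-2))/(borel_upow 1).
exact/(borel_t (-2))/(borel_upow 1).
Qed.

Lemma flips_borel b : in_borel b -> odd_part (phi b ord0 ord_max) = 1%N -> flips b.
Proof.
move=> [i [p [n [q ->]]]]; rewrite phi_borel.
rewrite mxE /=.
have [e ->] := signz i => E; apply: flips_scale.
have n0 : n != 0.
  by apply/eqP => n0; move: E; rewrite n0 mulr0 mul0r odd_part0.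
have [m [d [om En]]] := int_two_adic n0.
have m1 : `|m|%N = 1%N.
  have em : `|((-1) ^+ e * m)%R|%N = `|m|%N.
    by case: (e); rewrite ?expr1 ?mulN1r ?abszN // mul1r.
  rewrite -E -em -(@odd_partE R _ (d%:Z + (p - q))%R) ?em //.
  by congr odd_part; rewrite En expz2D !intrM !rmorphXn rmorphN !mulrA.
have [E1|E1] : m = 1%R \/ m = (-1)%R by lia.
  by rewrite En E1 mul1r; exact: flips_pow2.
by rewrite En E1 mulN1r zpowN; exact/flipsV/flips_pow2.
Qed.

(** * Euclidean expansions *)

Definition tl g : R := phi g ord0 ord0.
Definition lc g : R := phi g ord_max ord0.

Definition dyadic_SL2 (A : 'M[R]_2) := \det A = 1%R /\ forall i j : 'I_2, dyadic (A i j).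

Lemma dyadic_SL2_mx2 (a b c d : R) : dyadic a -> dyadic b -> dyadic c -> dyadic d ->
  (a * d - b * c = 1)%R -> dyadic_SL2 (mx2 a b c d).
Proof.
move=> da db dc dd E; split; first by rewrite det_mx2E !mxE.
by move=> i j; rewrite mxE; case: ifP; case: ifP.
Qed.

Lemma dyadic_SL2_mul A B : dyadic_SL2 A -> dyadic_SL2 B -> dyadic_SL2 (A *m B).
Proof.
move=> [dA A1] [dB B1]; split; first by rewrite det_mulmx dA dB mulr1.
by move=> i j; rewrite mulmx2; apply: dyadicD; apply: dyadicM.
Qed.

Lemma dyadic_1 : dyadic (1 : R)%R. Proof. exact: (dyadic_int R 1). Qed.

Lemma dyadic_sign (e : bool) : dyadic ((-1) ^+ e : R)%R.
Proof. by case: e; rewrite ?expr1; [apply: dyadicN|]; exact: dyadic_1. Qed.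

Lemma dyadic_SL2_borel b : in_borel b -> dyadic_SL2 (phi b).
Proof.
move=> /borel_phi [e [k [x [dx ->]]]]; apply: dyadic_SL2_mx2 => //.
- exact: dyadicM (dyadic_sign _) (dyadic_pow2 _ _).
- exact: dyadic0.
- exact: dyadicM (dyadic_sign _) (dyadic_pow2 _ _).
- by rewrite mulr0 subr0 mulrACA -expz2D subrr -expr2 sqrr_sign mulr1.
Qed.

Lemma dyadic_SL2_w : dyadic_SL2 (phi w).
Proof.
rewrite phiw; apply: dyadic_SL2_mx2; try exact: dyadic0.
- exact/dyadicN/dyadic_1.
- exact: dyadic_1.
- by rewrite mulr0 mulr1 opprK add0r.
Qed.

Lemma phiwV : phi w^-1 = mx2 0 1 (-1) 0.
Proof.
apply: (@phi_mulmxI w); rewrite -phiM mulgV phi1 phiw mul_mx2 -mx2_1.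
by congr mx2; ring.
Qed.

Lemma dyadic_SL2_wV : dyadic_SL2 (phi w^-1).
Proof.
rewrite phiwV; apply: dyadic_SL2_mx2; try exact: dyadic0.
- exact: dyadic_1.
- exact/dyadicN/dyadic_1.
- by rewrite mulr0 mulrN1 opprK add0r.
Qed.

(* Euclid's algorithm on the first column of [phi g]: each rotation [w] must
   strictly decrease the odd part of the lower-left entry. *)
Inductive euclidean : G -> Prop :=
| euclidean_borel b : in_borel b -> euclidean b
| euclidean_step b g : in_borel b -> euclidean g ->
    (odd_part (lc g) < odd_part (tl g))%N -> euclidean (b * w * g).

Lemma euclidean_SL2 g : euclidean g -> dyadic_SL2 (phi g).
Proof.
elim=> [b /dyadic_SL2_borel //|b h Bb _ Sh _]; rewrite !phiM.
by apply: dyadic_SL2_mul Sh; apply: dyadic_SL2_mul (dyadic_SL2_borel Bb) dyadic_SL2_w.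
Qed.

Lemma euclidean_bmul b g : in_borel b -> euclidean g -> euclidean (b * g).
Proof.
move=> Bb [b' Bb'|b' h Bb' Eh lt]; first exact/euclidean_borel/borelM.
by rewrite !mulgA; apply: euclidean_step => //; apply: borelM.
Qed.

Lemma lc_dyadic g : euclidean g -> dyadic (lc g).
Proof. by move=> /euclidean_SL2 [_ H]; apply: H. Qed.

Lemma tl_dyadic g : euclidean g -> dyadic (tl g).
Proof. by move=> /euclidean_SL2 [_ H]; apply: H. Qed.

Lemma lc_w g : lc (w * g) = tl g.
Proof. by rewrite /lc phiM mulmx2 phiw !mxE /= mul1r mul0r addr0. Qed.

Lemma tl_w g : tl (w * g) = (- lc g)%R.
Proof. by rewrite /tl phiM mulmx2 phiw !mxE /= mul0r mulN1r add0r. Qed.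

Lemma odd_part_lc_borel b g : in_borel b -> dyadic (lc g) ->
  odd_part (lc (b * g)) = odd_part (lc g).
Proof.
move=> /borel_phi [e [k [x [_ E]]]] dg.
rewrite {1}/lc phiM mulmx2 E !mxE /= mul0r add0r -/(lc g) mulrAC odd_partM2.
  by case: e {E}; rewrite ?expr1 ?mulN1r ?odd_partN // mul1r.
exact: dyadicM (dyadic_sign _) dg.
Qed.

Lemma lc_borel b : in_borel b -> lc b = 0%R.
Proof. by move=> /borel_phi [e [k [x [_ E]]]]; rewrite /lc E mxE. Qed.

Lemma phi_first_col g : \det (phi g) = 1%R ->
  (tl g * phi g ord_max ord_max - phi g ord0 ord_max * lc g = 1)%R.
Proof. by rewrite det_mx2E. Qed.

(** Up to powers of 2, [n] divides both entries of the first column, hence the determinant, which is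
    1. *)
Lemma euclidean_coprime g n k l (a c : int) : euclidean g ->
  tl g = ((a * n)%:~R * 2 ^ k)%R -> lc g = ((c * n)%:~R * 2 ^ l)%R -> odd `|n| ->
  `|n|%N = 1%N.
Proof.
move=> Eg Et El on; have [/phi_first_col dg dy] := euclidean_SL2 Eg.
have [] := @odd_dvd_dyadic R n 1
  (a%:~R * 2 ^ k * phi g ord_max ord_max - phi g ord0 ord_max * (c%:~R * 2 ^ l))%R => //.
- by apply/dyadicD/dyadicN/dyadicM => //; do 2?[apply: dyadicM => //];
    try exact: dyadic_int; exact: dyadic_pow2.
- by rewrite [RHS]mulr1z -[RHS]dg Et El !intrM; ring.
move=> q Eq; move: dg; rewrite Et El !intrM.
have -> : (a%:~R * n%:~R * 2 ^ k * phi g ord_max ord_max - phi g ord0 ord_max * (c%:~R *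
    n%:~R * 2 ^ l) = (q * n)%:~R :> R)%R.
  by rewrite intrM -Eq; ring.
move=> qn1; have qn : (q * n = 1)%R by apply: (intr_inj (R := R)); rewrite qn1.
have : (`|q| * `|n| = 1)%N by rewrite -abszM qn.
by move/eqP; rewrite muln_eq1 => /andP [_ /eqP].
Qed.

Lemma euclidean_lc0 g : euclidean g -> lc g = 0%R -> in_borel g /\ odd_part (tl g) = 1%N.
Proof.
move=> Eg; case: (Eg) => [b Bb _|b h Bb Eh lt].
  split=> //; move/borel_phi: Bb => [e [k [x [_ E]]]].
  rewrite /tl E mxE /= odd_partM2; last exact: dyadic_sign.
  by case: e {E}; rewrite ?expr1 ?odd_partN odd_part1.
move=> E; have : odd_part (lc (b * w * h)) = 0%N by rewrite E odd_part0.
rewrite -mulgA odd_part_lc_borel // ?lc_w; last exact: tl_dyadic.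
by move=> E0; move: lt; rewrite E0.
Qed.

Lemma euclidean_lc_inv g : euclidean g -> lc g <> 0%R -> exists b h,
  [/\ in_borel b, euclidean h, (odd_part (lc h) < odd_part (tl h))%N & g = b * w * h].
Proof. by case=> [b /lc_borel -> //|b h Bb Eh lt _]; exists b, h. Qed.

Lemma euclidean_col_eq g : euclidean g -> odd_part (lc g) = odd_part (tl g) ->
  odd_part (lc g) = 1%N.
Proof.
move=> Eg E; case: (pselect (lc g = 0%R)) => [l0|l0].
  by have [_ <-] := euclidean_lc0 Eg l0.
have t0 : tl g <> 0%R.
  move=> t0; apply: l0; apply: odd_part_eq0; first exact: lc_dyadic.
  by rewrite E t0 odd_part0.
have [m [k [om Em]]] := dyadic_odd (lc_dyadic Eg) l0.
have [n [l [on En]]] := dyadic_odd (tl_dyadic Eg) t0.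
move: E; rewrite {1}Em {1}En !odd_partE // => mn.
rewrite Em odd_partE //.
have [e Ee] : exists e : int, n = (e * m)%R.
  have [->|->] : n = m \/ n = (- m)%R by lia.
    by exists 1%R; rewrite mul1r.
  by exists (-1)%R; rewrite mulN1r.
apply: (@euclidean_coprime g m l k e 1) => //; first by rewrite En Ee.
by rewrite Em mul1r.
Qed.

(** A strict inequality is a step of the algorithm. Under equality both entries are units; then
    [g = b * w * h] with [h] triangular and the off-diagonal entry of [b] a unit, so [w * b * w]
    collapses to a single rotation. *)
Lemma euclidean_w_le g : euclidean g -> (odd_part (lc g) <= odd_part (tl g))%N ->
  euclidean (w * g).
Proof.
move=> Eg; rewrite leq_eqVlt => /orP [/eqP E|lt]; last first.
  by rewrite -[w * g]mul1g mulgA; apply: euclidean_step => //; exact: borel1.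
have l1 := euclidean_col_eq Eg E.
have l0 : lc g <> 0%R by move=> l0; move: l1; rewrite l0 odd_part0.
have [b [h [Bb Eh lt Dg]]] := euclidean_lc_inv Eg l0.
move: l1 E; rewrite {}Dg -mulgA odd_part_lc_borel // lc_w; last exact: tl_dyadic.
move=> t1; rewrite t1 => T1.
have h0 : lc h = 0%R.
  by apply: odd_part_eq0; [exact: lc_dyadic|move: lt; rewrite t1; case: odd_part].
have [Bh _] := euclidean_lc0 Eh h0.
have Fb : flips b.
  apply: flips_borel => //; apply: etrans (esym T1).
  rewrite {1}/tl phiM mulmx2 -[phi (w * h) ord0 ord0]/(tl (w * h))
    -[phi (w * h) ord_max ord0]/(lc (w * h)) tl_w lc_w h0 oppr0 mulr0 add0r.
  have th0 : tl h <> 0%R by move=> E; move: t1; rewrite E odd_part0.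
  have [m [k [om Em]]] := dyadic_odd (tl_dyadic Eh) th0.
  move: t1; rewrite Em odd_partE // => m1.
  have db : dyadic (phi b ord0 ord_max) by case: (dyadic_SL2_borel Bb).
  rewrite mulrA odd_partM2; last exact: dyadicM (dyadic_int _ _).
  have [->|->] : m = 1%R \/ m = (-1)%R by lia.
    by rewrite mulr1.
  by rewrite rmorphN mulrN1 odd_partN.
have [b1 [b2 [B1 B2 Ew]]] := Fb.
rewrite !mulgA Ew -mulgA.
apply: euclidean_step => //; first exact/euclidean_borel/borelM.
have /euclidean_lc0 [] : euclidean (b2 * h) by exact/euclidean_borel/borelM.
  by rewrite lc_borel //; exact: borelM.
by move=> Bbh ->; rewrite lc_borel // odd_part0.
Qed.

Lemma euclidean_surj (A : 'M[R]_2) : dyadic_SL2 A -> exists2 g, euclidean g & phi g = A.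
Proof.
have [N] := ubnP (odd_part (A ord_max ord0)).
elim: N A => // N IH A; rewrite ltnS => leN [dA A1].
move: dA; rewrite det_mx2E => dA.
case: (pselect (A ord_max ord0 = 0%R)) => [c0|c0].
  have [||||b Bb Eb] := @borel_surj (A ord0 ord0) (A ord0 ord_max) (A ord_max ord_max) => //.
    by rewrite -dA c0 mulr0 subr0.
  by exists b; [exact: euclidean_borel|rewrite Eb [RHS]mx2_eta c0].
have [x dx lt] := dyadic_division (A1 ord0 ord0) (A1 ord_max ord0) c0.
have [||||b Bb Eb] := @borel_surj 1%R x 1%R => //; try exact: dyadic_1; first by rewrite mulr1.
have lA' : (phi w^-1 *m (phi b *m A)) ord_max ord0 = (- (A ord0 ord0 + x * A ord_max ord0))%R.
  by rewrite phiwV Eb !mulmx2 !mxE /=; ring.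
have tA' : (phi w^-1 *m (phi b *m A)) ord0 ord0 = A ord_max ord0.
  by rewrite phiwV Eb !mulmx2 !mxE /=; ring.
have [||g Eg Pg] := IH (phi w^-1 *m (phi b *m A)).
- by rewrite lA' odd_partN; apply: leq_trans lt leN.
- apply: dyadic_SL2_mul; last first.
    by apply: dyadic_SL2_mul; [exact: dyadic_SL2_borel|split; rewrite ?det_mx2E].
  exact: dyadic_SL2_wV.
exists (b^-1 * w * g).
  apply: euclidean_step => //; first exact: borelV.
  by rewrite /lc /tl Pg lA' tA' odd_partN.
by rewrite !phiM Pg !mulmxA -!phiM mulgK mulVg phi1 mul1mx.
Qed.

(** * Two expansions of one matrix agree up to powers of [z] *)

(* [flips b] moves [b] past a rotation either in front of [x] or in front of [y];
   one of the two is compatible with Euclid's algorithm. *)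
Lemma rigid_step N x y b : (forall g h, (odd_part (lc g) < N)%N ->
    euclidean g -> euclidean h -> phi g = phi h -> central_eq g h) ->
  euclidean x -> euclidean y -> in_borel b -> flips b ->
  (odd_part (lc x) < N)%N -> (odd_part (lc y) < N)%N ->
  phi (w * x) = phi (b * (w * y)) -> central_eq (w * x) (b * (w * y)).
Proof.
move=> IH Ex Ey Bb [b1 [b2 [B1 B2 E]]] ltx lty P.
have phi_eq : phi (z * x) = phi (b1 * (w * (b2 * y))).
  rewrite -ww -(mulgA w w x) (phiM w (w * x)) P -phiM; congr phi.
  by rewrite !mulgA E.
have key : central_eq x (b1 * (w * (b2 * y))) -> central_eq (w * x) (b * (w * y)).
  move=> K; apply: (@central_eq_cancel w).
  have -> : w * (b * (w * y)) = b1 * (w * (b2 * y)) by rewrite !mulgA E.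
  apply: central_eq_trans K; rewrite mulgA ww; by exists 1%R.
apply: key.
have zx : central_eq x (z * x) by apply: central_eq_sym; exists 1%R.
have E2 : euclidean (b2 * y) by apply: euclidean_bmul.
have Ezx : euclidean (z * x) by apply: euclidean_bmul => //; exact: (borel_zpow 1).
have ltzx : (odd_part (lc (z * x)) < N)%N.
  by rewrite odd_part_lc_borel //; [exact: (borel_zpow 1)|exact: lc_dyadic].
case: (leqP (odd_part (lc (b2 * y))) (odd_part (tl (b2 * y)))) => le.
  apply: central_eq_trans zx _; apply: IH => //.
  exact/euclidean_bmul/euclidean_w_le.
(* Otherwise [b1^-1 * (z * x)], having the matrix of [w * (b2 * y)], has its column in the opposite
   order. A further [w] in front of it is then legal, and the result is compared with
   [z * (b2 * y)]. *)
apply: central_eq_trans zx _; apply: (@central_eq_cancel b1^-1); rewrite mulKg.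
have P1 : phi (b1^-1 * (z * x)) = phi (w * (b2 * y)).
  by apply: (@phi_cancel b1); rewrite mulVKg.
have E1 : euclidean (b1^-1 * (z * x)) by apply: euclidean_bmul => //; exact: borelV.
apply: (@central_eq_cancel w).
have P2 : phi (w * (b1^-1 * (z * x))) = phi (z * (b2 * y)).
  by rewrite phiM P1 -phiM mulgA ww.
rewrite (mulgA w w) ww; apply: central_eq_sym; apply: IH => //.
- rewrite odd_part_lc_borel; [|exact: (borel_zpow 1)|exact: lc_dyadic].
  by rewrite odd_part_lc_borel //; exact: lc_dyadic.
- by apply: euclidean_bmul => //; exact: (borel_zpow 1).
- apply: euclidean_w_le => //.
  by rewrite /lc /tl P1 -/(lc _) -/(tl _) lc_w tl_w odd_partN ltnW.
Qed.

(** In the step [w * x] the entry [tl x] is the divisor and [lc x], up to sign, the remainder: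
    changing the quotient by [r] changes the remainder by [r] times the divisor. *)
Lemma lc_wV x y b r : phi b = mx2 1 r 0 1 -> phi (w * x) = phi (b * (w * y)) ->
  tl x = tl y /\ lc x = (lc y - r * tl y)%R.
Proof.
move=> Pb P; split; first by rewrite -!lc_w /lc P phiM mulmx2 Pb !mxE /= mul0r add0r mul1r.
apply: oppr_inj; rewrite -tl_w /tl P phiM mulmx2 Pb !mxE /=.
rewrite -[phi (w * y) ord0 ord0]/(tl (w * y)) -[phi (w * y) ord_max ord0]/(lc (w * y)).
by rewrite tl_w lc_w -/(tl y); ring.
Qed.

Lemma borel_unipotent x y b (N : nat) : in_borel b -> (0 < N)%N ->
  tl x = N%:R%R -> tl y = N%:R%R -> phi (w * x) = phi (b * (w * y)) ->
  exists2 r, dyadic r & phi b = mx2 1 r 0 1.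
Proof.
move=> Bb N0 tx ty P; have [db /(_ ord0 ord_max) dr] := dyadic_SL2_borel Bb.
have lb := lc_borel Bb.
exists (phi b ord0 ord_max) => //.
have d1 : phi b ord_max ord_max = 1%R.
  have : lc (w * x) = lc (b * (w * y)) by rewrite /lc P.
  rewrite {2}/lc phiM mulmx2 -[phi b ord_max ord0]/(lc b) lb mul0r add0r.
  rewrite -[phi (w * y) ord_max ord0]/(lc (w * y)) !lc_w tx ty.
  move/esym/(canRL (mulfK _)); rewrite divff => [->//|]; by rewrite pnatr_eq0 -lt0n.
move: db; rewrite det_mx2E d1 -/(lc b) lb mulr0 subr0 mulr1 => a1.
by rewrite {1}(mx2_eta (phi b)) a1 d1 -/(lc b) lb.
Qed.

Lemma rigid_base N x y b : (forall g h, (odd_part (lc g) < N)%N ->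
    euclidean g -> euclidean h -> phi g = phi h -> central_eq g h) ->
  euclidean x -> euclidean y -> in_borel b -> (odd_part (lc x) < N)%N ->
  phi b = mx2 1 0 0 1 ->
  phi (w * x) = phi (b * (w * y)) -> central_eq (w * x) (b * (w * y)).
Proof.
move=> IH Ex Ey Bb lt Pb P.
have [i ->] : central_eq b 1 by apply: borel_phi1; rewrite // Pb mx2_1.
rewrite mulg1; apply: (@central_eq_trans _ (w * y)); last by exists (- i)%R; rewrite zpowN mulKg.
apply/central_eq_mull/IH => //; apply: (@phi_cancel w).
by rewrite P phiM Pb mx2_1 mul1mx.
Qed.

(** A nonzero class modulo the odd number [N] has two representatives strictly between [-N] and [N];
    they differ by [N], so exactly one is odd. Hence each exponent [k] carries one odd [m]. Passing
    from [k] to [k + 1] replaces [m] by whichever of [(m + N) / 2] and [(m - N) / 2] is odd and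
    changes the quotient by plus or minus [2^k], a change covered by [rigid_step]. The number of
    such moves is [d]. *)
Lemma rigid_chain (N : nat) (d : nat) x y b k (m m' : int) : odd N ->
  (forall g h, (odd_part (lc g) < N)%N ->
    euclidean g -> euclidean h -> phi g = phi h -> central_eq g h) ->
  euclidean x -> euclidean y -> in_borel b ->
  tl x = N%:R%R -> tl y = N%:R%R ->
  lc x = (m%:~R * 2 ^ k)%R -> lc y = (m'%:~R * 2 ^ (k + d%:Z))%R ->
  odd `|m| -> odd `|m'| -> (`|m| < N)%N -> (`|m'| < N)%N ->
  phi (w * x) = phi (b * (w * y)) -> central_eq (w * x) (b * (w * y)).
Proof.
move=> oN IH; elim: d x b k m => [|d IHd] x b k m Ex Ey Bb tx ty lx ly om om' mN m'N P.
  have N0 : (0 < N)%N by exact: leq_ltn_trans mN.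
  have [r dr Pb] := borel_unipotent Bb N0 tx ty P.
  have [_ lxy] := lc_wV Pb P.
  have rN : (r * 2 ^ (- k) * N%:~R = (m' - m)%:~R :> R)%R.
    move: lxy; rewrite lx ly addr0 ty rmorphB /= => E.
    apply: (mulIf (expz2_neq0 R k)).
    rewrite -!mulrA (mulrC N%:~R%R) (mulrA (2 ^ (- k))%R) -expz2D addNr mul1r mulrBl E.
    by rewrite opprB subrKC.
  have [] := @odd_dvd_dyadic R N (m' - m)%R (r * 2 ^ (- k))%R => //.
    exact: dyadicM dr (dyadic_pow2 _ _).
  move=> q Eq.
  have qN : (q * N%:Z = m' - m)%R by apply: (intr_inj (R := R)); rewrite intrM -Eq.
  (* The difference [m' - m] is even and less than [2 * N] in absolute value, while [N] is odd: the
     multiple [q] must be even, hence 0. *)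
  have q0 : q = 0%R.
    have [p Ep] : exists p : int, (m' - m = 2 * p)%R by exists ((m' - m) %/ 2)%Z; lia.
    have [M EM] : exists M : int, (N%:Z = 2 * M + 1)%R by exists (N%:Z %/ 2)%Z; lia.
    have Eq2 : (q = 2 * (p - q * M))%R by rewrite EM in qN; lia.
    move: (p - q * M)%R Eq2 qN => q' -> {Eq}; rewrite Ep -mulrA => qN.
    have {}qN : (q' * N%:Z = p)%R by lia.
    have {Ep EM} : (- N%:Z < p < N%:Z)%R by lia.
    rewrite -qN; case: (ltrgtP q' 0) => [q0|q0|->]; last by rewrite mulr0.
    - by nia.
    - by nia.
  have r0 : r = 0%R.
    by move/eqP: Eq; rewrite q0 mulf_eq0 (negPf (expz2_neq0 _ _)) orbF => /eqP.
  apply: (rigid_base IH) => //; last by rewrite Pb r0.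
  by rewrite lx odd_partE.
have [e [m2 [om2 Em2 m2N]]] : exists (e : bool) (m2 : int),
    [/\ odd `|m2|, (2 * m2 = m + (-1) ^+ e * N%:Z)%R & (`|m2| < N)%N].
  case: (boolP (odd `|((m + N%:Z) %/ 2)%Z|)) => oo.
    by exists false, ((m + N%:Z) %/ 2)%Z; split; rewrite ?expr0 //; lia.
  by exists true, ((m - N%:Z) %/ 2)%Z; split; rewrite ?expr1 //; lia.
have [||||b1 B1 P1] := @borel_surj 1%R ((-1) ^+ e * 2 ^ k)%R 1%R.
- exact: dyadic_1.
- exact: dyadicM (dyadic_sign _) (dyadic_pow2 _ _).
- exact: dyadic_1.
- by rewrite mulr1.
(* The intermediate remainder needs an expansion of its own; surjectivity supplies one with the
   matrix that [b1] forces. *)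
have [|x2 Ex2 Px2] := @euclidean_surj (phi (w^-1 * (b1^-1 * (w * x)))).
  rewrite !phiM; apply: dyadic_SL2_mul dyadic_SL2_wV _.
  apply: dyadic_SL2_mul; first exact/dyadic_SL2_borel/borelV.
  by apply: dyadic_SL2_mul dyadic_SL2_w _; exact: euclidean_SL2.
have Pw2 : phi (w * x2) = phi (b1^-1 * (w * x)) by rewrite phiM Px2 -phiM mulVKg.
have Pw : phi (w * x) = phi (b1 * (w * x2)) by rewrite (phiM b1) Pw2 -phiM mulVKg.
have [tx2 lx2] := lc_wV P1 Pw; rewrite tx in tx2.
have lx2' : lc x2 = (m2%:~R * 2 ^ (k + 1))%R.
  move: lx2; rewrite lx -tx2 => /eqP; rewrite eq_sym subr_eq => /eqP ->.
  rewrite expz2D expr1z.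
  have -> : (m2%:~R * (2 ^ k * 2) = (2 * m2)%:~R * 2 ^ k :> R)%R by rewrite intrM; ring.
  by rewrite Em2 rmorphD /= intrM rmorphXn /= rmorphN; ring.
apply: (@central_eq_trans _ (b1 * (w * x2))).
  apply: (rigid_step IH) => //.
  - apply: flips_borel => //; rewrite P1 mxE /= odd_partM2; last exact: dyadic_sign.
    by case: (e); rewrite ?expr1 ?odd_partN odd_part1.
  - by rewrite lx odd_partE.
  - by rewrite lx2' odd_partE.
apply: (@central_eq_cancel b1^-1); rewrite mulKg [b1^-1 * _]mulgA.
apply: (IHd _ _ (k + 1)%R m2) => //.
- by apply: borelM => //; exact: borelV.
- by rewrite ly; congr (_ * 2 ^ _)%R; lia.
- by rewrite Pw2 -mulgA !(phiM b1^-1) P.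
Qed.

(** Powers of [z] and [u] cross the rotation and make the divisor a positive odd integer, so that
    two expansions of one matrix have literally the same divisor. *)
Lemma euclidean_normalize x : euclidean x -> tl x <> 0%R -> exists b' x1,
  [/\ in_borel b', euclidean x1, w * x = b' * (w * x1),
      tl x1 = (odd_part (tl x))%:R%R & odd_part (lc x1) = odd_part (lc x)] /\
  odd (odd_part (tl x)).
Proof.
move=> Ex t0; have [n [k [on En]]] := dyadic_odd (tl_dyadic Ex) t0.
pose e : int := (n < 0)%R.
pose c := zpow z e * zpow u (- k)%R.
have Bc : in_borel c by apply/borel_z/borel_upow.
have e2 : ((-1) ^ e * n%:~R = `|n|%N%:R :> R)%R.
  rewrite /e; case: (ltrP n 0) => n0 /=.
    by rewrite expr1z mulN1r -rmorphN -[RHS]mulrz_nat; congr intmul; lia.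
  by rewrite expr0z mul1r -[RHS]mulrz_nat; congr intmul; lia.
exists (zpow z (- e)%R * zpow u (- k)%R), (c * x); split; last by rewrite En odd_partE.
split.
- exact/borel_z/borel_upow.
- exact: euclidean_bmul.
- rewrite /c !mulgA; congr (_ * x).
  rewrite -!(zpow_central e) !mulgA -zpowD addrN mul1g -mulgA rotate_scale.
  by rewrite opprK mulgA -zpowD addNr mul1g.
- rewrite En odd_partE // /tl phiM /c phiM phi_z phi_u mul_mx2 mulmx2 !mxE /=.
  rewrite -[phi x ord0 ord0]/(tl x) En !mul0r !mulr0 !addr0 mul0r addr0.
  rewrite -e2 [(n%:~R * _)%R]mulrC mulrA -(mulrA ((-1) ^ e)%R) -expz2D addNr mulr1 //.
- by rewrite odd_part_lc_borel //; exact: lc_dyadic.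
Qed.

(** After normalization both expansions divide by the same [N]. If [N = 1], both remainders vanish
    and the quotients agree. Otherwise both are nonzero, and the one with the smaller power of 2 is
    moved along the chain to the other. *)
Lemma euclidean_rigid g h :
  euclidean g -> euclidean h -> phi g = phi h -> central_eq g h.
Proof.
have [M] := ubnP (odd_part (lc g)).
elim: M g h => // M IHM g h; rewrite ltnS => leM Eg Eh P.
have lgh : lc g = lc h by rewrite /lc P.
case: (pselect (lc g = 0%R)) => l0.
  have [Bg _] := euclidean_lc0 Eg l0.
  have [Bh _] : in_borel h /\ odd_part (tl h) = 1%N by apply: euclidean_lc0; rewrite // -lgh.
  apply: (@central_eq_cancel h^-1); rewrite mulVg; apply: borel_phi1.
    by apply: borelM => //; exact: borelV.
  by rewrite phiM P -phiM mulVg phi1.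
have [b1 [x [B1 Ex ltx Dg]]] := euclidean_lc_inv Eg l0.
have [b2 [y [B2 Ey lty Dh]]] : exists b h', [/\ in_borel b, euclidean h',
    (odd_part (lc h') < odd_part (tl h'))%N & h = b * w * h'].
  by apply: euclidean_lc_inv; rewrite // -lgh.
have opx : odd_part (lc g) = odd_part (tl x).
  by rewrite Dg -mulgA odd_part_lc_borel // lc_w //; exact: tl_dyadic.
have opy : odd_part (lc g) = odd_part (tl y).
  by rewrite lgh Dh -mulgA odd_part_lc_borel // lc_w //; exact: tl_dyadic.
have tx0 : tl x <> 0%R by move=> E; move: ltx; rewrite E odd_part0.
have ty0 : tl y <> 0%R by move=> E; move: lty; rewrite E odd_part0.
have [c1 [x1 [[C1 Ex1 wx1 tx1 lx1] oN]]] := euclidean_normalize Ex tx0.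
have [c2 [y1 [[C2 Ey1 wy1 ty1 ly1] _]]] := euclidean_normalize Ey ty0.
rewrite -lx1 in ltx; rewrite -ly1 in lty.
rewrite -opx in tx1 oN ltx; rewrite -opy in ty1 lty.
move: (odd_part (lc g)) leM tx1 ty1 oN ltx lty {opx opy lx1 ly1 tx0 ty0} => N leM tx1 ty1
    oN ltx lty.
have IH : forall g h, (odd_part (lc g) < N)%N ->
    euclidean g -> euclidean h -> phi g = phi h -> central_eq g h.
  by move=> g' h' lt; apply: IHM; apply: leq_trans lt leM.
pose b := (b1 * c1)^-1 * (b2 * c2).
have Bb : in_borel b by apply: borelM; [apply: borelV|]; apply: borelM.
have Dg' : g = (b1 * c1) * (w * x1) by rewrite Dg -mulgA wx1 mulgA.
have Dh' : h = (b1 * c1) * (b * (w * y1)).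
  by rewrite /b -(mulgA (b1 * c1)^-1) mulVKg Dh -mulgA wy1 !mulgA.
have Pxy : phi (w * x1) = phi (b * (w * y1)).
  by apply: (@phi_cancel (b1 * c1)); rewrite -Dg' -Dh'.
rewrite Dg' Dh'; apply: central_eq_mull.
have N0 : (0 < N)%N by exact: leq_ltn_trans ltx.
have [r dr Pb] := borel_unipotent Bb N0 tx1 ty1 Pxy.
have [_ lxy] := lc_wV Pb Pxy.
have N1 v : euclidean v -> tl v = N%:R%R -> lc v = 0%R -> N = 1%N.
  move=> Ev tv lv; have [_] := euclidean_lc0 Ev lv.
  have -> : tl v = (N%:Z%:~R * 2 ^ 0)%R by rewrite tv mulr1.
  by rewrite odd_partE.
case: (eqVneq N 1%N) => [N1'|N1'].
  have x0 : lc x1 = 0%R by apply: odd_part_eq0; [exact: lc_dyadic|move: ltx; rewrite N1';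
      case: odd_part].
  have y0 : lc y1 = 0%R by apply: odd_part_eq0; [exact: lc_dyadic|move: lty; rewrite N1';
      case: odd_part].
  apply: (rigid_base IH) => //; rewrite Pb; congr mx2.
  by move: lxy; rewrite x0 y0 ty1 N1' mulr1 sub0r => /eqP; rewrite eq_sym oppr_eq0 => /eqP.
have x0 : lc x1 <> 0%R by move/(N1 x1 Ex1 tx1)/eqP; rewrite (negPf N1').
have y0 : lc y1 <> 0%R by move/(N1 y1 Ey1 ty1)/eqP; rewrite (negPf N1').
have [m [k [om Em]]] := dyadic_odd (lc_dyadic Ex1) x0.
have [m' [k' [om' Em']]] := dyadic_odd (lc_dyadic Ey1) y0.
rewrite Em odd_partE // in ltx; rewrite Em' odd_partE // in lty.
case: (lerP k k') => kk.
  apply: (@rigid_chain N `|k' - k|%N x1 y1 b k m m') => //.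
  by rewrite Em'; congr (_ * 2 ^ _)%R; lia.
apply: (@central_eq_cancel b^-1); rewrite mulKg; apply: central_eq_sym.
apply: (@rigid_chain N `|k - k'|%N y1 x1 b^-1 k' m' m) => //.
- exact: borelV.
- by rewrite Em; congr (_ * 2 ^ _)%R; lia.
- by apply: (@phi_cancel b); rewrite mulVKg.
Qed.

(** Rigidity turns existence into closure. When [w] is not a legal step at [g], some expansion [h]
    has the matrix of [w * g]; its column is in the order that makes [w * h] an expansion too, and
    [w * h] must agree with [z * g] up to a power of [z]. *)
Lemma euclidean_mulw g : euclidean g -> euclidean (w * g).
Proof.
move=> Eg; case: (leqP (odd_part (lc g)) (odd_part (tl g))) => [|lt].
  exact: euclidean_w_le.
have [|h Eh Ph] := @euclidean_surj (phi (w * g)).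
  by rewrite phiM; apply: dyadic_SL2_mul dyadic_SL2_w _; exact: euclidean_SL2.
have Ewh : euclidean (w * h).
  apply: euclidean_w_le => //; rewrite /lc /tl Ph -/(lc _) -/(tl _).
  by rewrite lc_w tl_w odd_partN ltnW.
have [i Ei] : central_eq (w * h) (z * g).
  apply: euclidean_rigid => //; last by rewrite phiM Ph -phiM mulgA ww.
  exact/(euclidean_bmul (borel_zpow 1)).
have -> : w * g = zpow z (- i)%R * h.
  by apply: (mulgI w); rewrite mulgA ww mulgA -zpow_central -mulgA Ei zpowN mulKg.
exact/euclidean_bmul/Eh/borel_zpow.
Qed.

End WordProblem.

(** * Boundaries in the bar complex *)

Section Homology.
Variables (T : Type) (mul : T -> T -> T) (one : T) (inv : T -> T) (S : T -> Prop).
Variable K : comPzRingType.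
Hypothesis mulA : associative mul.
Hypothesis one_l : left_id one mul.
Hypothesis one_r : right_id one mul.
Hypothesis mulV : forall g, S g -> mul g (inv g) = one.
Hypothesis mulVl : forall g, S g -> mul (inv g) g = one.
Hypothesis S1 : S one.
Hypothesis SM : forall g h, S g -> S h -> S (mul g h).
Hypothesis SV : forall g, S g -> S (inv g).

Local Notation chain := (chain T K).
Local Notation bd2 := (@bd2 T mul K).
Local Notation bd3 := (@bd3 T mul K).
Implicit Types (c d : chain) (f : seq T -> K).

Lemma coeff_cat c d x : coeff (c ++ d) x = coeff c x + coeff d x.
Proof. by rewrite /coeff big_cat. Qed.

Lemma coeff_nil x : coeff ([::] : chain) x = 0.
Proof. by rewrite /coeff big_nil. Qed.

Definition basis (y : seq T) : seq T -> K := fun x => (`[< y = x >])%:R.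

Lemma coeff_cons a y c x : coeff ((a, y) :: c) x = a * basis y x + coeff c x.
Proof. by rewrite /coeff /basis big_cons /=; case: asbool; rewrite ?mulr1 // mulr0 add0r. Qed.

Definition scale_chain (a : K) c : chain := [seq (a * p.1, p.2) | p <- c].

Lemma coeff_scale a c x : coeff (scale_chain a c) x = a * coeff c x.
Proof. by rewrite /coeff big_map mulr_sumr. Qed.

Lemma is_chain_scale n a c : is_chain S n c -> is_chain S n (scale_chain a c).
Proof. by move=> H p /List.in_map_iff [q [<- /H]]. Qed.

Lemma is_chain_cat n c d : is_chain S n c -> is_chain S n d -> is_chain S n (c ++ d).
Proof. by move=> Hc Hd p /List.in_app_iff [/Hc|/Hd]. Qed.

Lemma bd2_cat c d : bd2 (c ++ d) = bd2 c ++ bd2 d.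
Proof. by rewrite /Defs.bd2 map_cat flatten_cat. Qed.

Lemma bd3_cat c d : bd3 (c ++ d) = bd3 c ++ bd3 d.
Proof. by rewrite /Defs.bd3 map_cat flatten_cat. Qed.

Lemma bd2_scale a c : bd2 (scale_chain a c) = scale_chain a (bd2 c).
Proof.
rewrite /Defs.bd2 /scale_chain map_flatten -!map_comp; congr flatten.
apply: eq_map => -[b [|g [|h [|k l]]]] //=.
by rewrite /bd2_term /= mulrN.
Qed.

Lemma bd3_scale a c : bd3 (scale_chain a c) = scale_chain a (bd3 c).
Proof.
rewrite /Defs.bd3 /scale_chain map_flatten -!map_comp; congr flatten.
apply: eq_map => -[b [|g [|h [|k [|? ?]]]]] //=.
by rewrite /bd3_term /= mulrN.
Qed.

(** Chains are lists that matter only through [coeff]. Boundaries are therefore handled as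
    coefficient functions, where an identity can be checked pointwise in the ring. *)
Definition bound1 f := exists2 d, is_chain S 2 d & forall x, f x = coeff (bd2 d) x.
Definition bound2 f := exists2 d, is_chain S 3 d & forall x, f x = coeff (bd3 d) x.

Lemma bound1_ext f1 f2 : (forall x, f1 x = f2 x) -> bound1 f1 -> bound1 f2.
Proof. by move=> E [d Hd Ed]; exists d => // x; rewrite -E. Qed.

Lemma bound2_ext f1 f2 : (forall x, f1 x = f2 x) -> bound2 f1 -> bound2 f2.
Proof. by move=> E [d Hd Ed]; exists d => // x; rewrite -E. Qed.

Lemma bound1_add f1 f2 : bound1 f1 -> bound1 f2 -> bound1 (fun x => f1 x + f2 x).
Proof.
move=> [d Hd Ed] [e He Ee]; exists (d ++ e); first exact: is_chain_cat.
by move=> x; rewrite bd2_cat coeff_cat Ed Ee.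
Qed.

Lemma bound2_add f1 f2 : bound2 f1 -> bound2 f2 -> bound2 (fun x => f1 x + f2 x).
Proof.
move=> [d Hd Ed] [e He Ee]; exists (d ++ e); first exact: is_chain_cat.
by move=> x; rewrite bd3_cat coeff_cat Ed Ee.
Qed.

Lemma bound1_scale a f : bound1 f -> bound1 (fun x => a * f x).
Proof.
move=> [d Hd Ed]; exists (scale_chain a d); first exact: is_chain_scale.
by move=> x; rewrite bd2_scale coeff_scale Ed.
Qed.

Lemma bound2_scale a f : bound2 f -> bound2 (fun x => a * f x).
Proof.
move=> [d Hd Ed]; exists (scale_chain a d); first exact: is_chain_scale.
by move=> x; rewrite bd3_scale coeff_scale Ed.
Qed.

Lemma bound1_sub f1 f2 : bound1 f1 -> bound1 f2 -> bound1 (fun x => f1 x - f2 x).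
Proof.
move=> H1 /(bound1_scale (-1)) H2; apply: bound1_ext (bound1_add H1 H2) => x.
by rewrite mulN1r.
Qed.

Lemma bound2_sub f1 f2 : bound2 f1 -> bound2 f2 -> bound2 (fun x => f1 x - f2 x).
Proof.
move=> H1 /(bound2_scale (-1)) H2; apply: bound2_ext (bound2_add H1 H2) => x.
by rewrite mulN1r.
Qed.

Lemma bound1_0 : bound1 (fun=> 0).
Proof. by exists [::] => // x; rewrite coeff_nil. Qed.

Lemma bound2_0 : bound2 (fun=> 0).
Proof. by exists [::] => // x; rewrite coeff_nil. Qed.

Lemma bound1_cycle g h : S g -> S h ->
  bound1 (fun x => basis [:: h] x - basis [:: mul g h] x + basis [:: g] x).
Proof.
move=> Sg Sh; exists [:: (1, [:: g; h])].
  by move=> p [<-|[]] /=; split=> // k [<-|[<-|[]]].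
by move=> x; rewrite !coeff_cons coeff_nil /=; ring.
Qed.

Lemma bound2_cocycle g h k : S g -> S h -> S k ->
  bound2 (fun x => basis [:: h; k] x - basis [:: mul g h; k] x
                 + basis [:: g; mul h k] x - basis [:: g; h] x).
Proof.
move=> Sg Sh Sk; exists [:: (1, [:: g; h; k])].
  by move=> p [<-|[]] /=; split=> // l [<-|[<-|[<-|[]]]].
by move=> x; rewrite !coeff_cons coeff_nil /=; ring.
Qed.

(** * Words in the generators and the tautological extension *)

Section Words.
Variable gens : seq T.
Hypothesis Sgens : forall g, List.In g gens -> S g.
Local Notation ev := (eval_word mul one inv gens).

Definition letter (ib : nat * bool) : T :=
  if ib.2 then inv (nth one gens ib.1) else nth one gens ib.1.

Lemma nth_gens i : S (nth one gens i).
Proof.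
elim: gens i Sgens => [|g l IH] [|i] H //=; first by apply: H; left.
by apply: IH => h hl; apply: H; right.
Qed.

Lemma letter_S ib : S (letter ib).
Proof. by rewrite /letter; case: ifP => _; [apply: SV|]; exact: nth_gens. Qed.

Lemma ev_cons ib v : ev (ib :: v) = mul (letter ib) (ev v).
Proof. by []. Qed.

Lemma ev_S v : S (ev v).
Proof. by elim: v => [|ib v IH] //=; apply: SM => //; exact: letter_S. Qed.

Lemma ev_cat v v' : ev (v ++ v') = mul (ev v) (ev v').
Proof. by elim: v => [|ib v IH] /=; rewrite ?one_l // IH mulA. Qed.

Lemma letter_inv i b : mul (letter (i, b)) (letter (i, ~~ b)) = one.
Proof. by case: b; rewrite /letter /= ?mulVl ?mulV //; exact: nth_gens. Qed.

Lemma pres_equiv_ev (rels : seq word) v v' :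
  (forall r, r \in rels -> ev r = one) -> pres_equiv rels v v' -> ev v = ev v'.
Proof.
move=> Hr; elim=> [{}v {}v' H|//|{}v {}v' _ -> //|v1 v2 v3 _ -> _ -> //].
case: H => [u y i b|u y r rr]; rewrite !ev_cat; congr mul.
  by rewrite !ev_cons mulA letter_inv one_l.
by rewrite Hr // one_l.
Qed.

Definition letter_sum (l : nat -> seq T -> K) (v : word) x : K :=
  \sum_(ib <- v) (if ib.2 then - l ib.1 x else l ib.1 x).

(** Modulo boundaries [[g h] = [g] + [h]], so the class of a word depends only on its exponent
    sums. *)
Lemma bound1_word v : bound1 (fun x => basis [:: ev v] x -
  letter_sum (fun i => basis [:: nth one gens i]) v x).
Proof.
have b1 : bound1 (basis [:: one]).
  by apply: bound1_ext (bound1_cycle S1 S1) => x; rewrite one_l; ring.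
elim: v => [|[i b] v IH].
  by apply: bound1_ext b1 => x; rewrite /letter_sum big_nil subr0.
have H := bound1_cycle (letter_S (i, b)) (ev_S v).
have Hb : bound1 (fun x => basis [:: letter (i, b)] x -
    (if b then - basis [:: nth one gens i] x else basis [:: nth one gens i] x)).
  case: b {H}; last by apply: bound1_ext bound1_0 => x; rewrite subrr.
  have := bound1_cycle (nth_gens i) (SV (nth_gens i)); rewrite mulV; last exact: nth_gens.
  move=> H; apply: bound1_ext (bound1_add H b1) => x; rewrite /letter /=; ring.
apply: bound1_ext (bound1_sub (bound1_add Hb IH) H) => x.
by rewrite ev_cons /letter_sum big_cons /=; ring.
Qed.

Section Splitting.
Variables (rels : seq word) (l : nat -> seq T -> K).
Hypothesis ev_rels : forall r, r \in rels -> ev r = one.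

(** The tautological 2-cocycle with values in 2-chains modulo boundaries. Subtracting [[1|1]]
    normalizes it: it becomes a boundary as soon as one argument is the identity. *)
Let sg g h x : K := basis [:: g; h] x - basis [:: one; one] x.

Lemma sg_cocycle g h k : S g -> S h -> S k ->
  bound2 (fun x => sg h k x - sg (mul g h) k x + sg g (mul h k) x - sg g h x).
Proof.
by move=> Sg Sh Sk; apply: bound2_ext (bound2_cocycle Sg Sh Sk) => x; rewrite /sg; ring.
Qed.

Lemma sg_1l h : S h -> bound2 (sg one h).
Proof. by move=> Sh; apply: bound2_ext (sg_cocycle S1 S1 Sh) => x; rewrite !one_l /sg; ring. Qed.

Lemma sg_1r h : S h -> bound2 (sg h one).
Proof.
move=> Sh; apply: bound2_ext (bound2_scale (-1) (sg_cocycle Sh S1 S1)) => x.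
by rewrite one_r one_l /sg; ring.
Qed.

(* The central coordinate of the word [v] in the extension with cocycle [sg],
   when the generator [i] is lifted with coordinate [l i]. *)
Fixpoint lift_coord (v : word) x : K :=
  if v is ib :: v' then
    (if ib.2 then - l ib.1 x - sg (nth one gens ib.1) (inv (nth one gens ib.1)) x
     else l ib.1 x) + lift_coord v' x + sg (letter ib) (ev v') x
  else 0.

Lemma lift_coord_cat v v' : bound2 (fun x => lift_coord (v ++ v') x -
  lift_coord v x - lift_coord v' x - sg (ev v) (ev v') x).
Proof.
elim: v => [|ib v IH].
  apply: bound2_ext (bound2_scale (-1) (sg_1l (ev_S v'))) => x /=; ring.
have H := sg_cocycle (letter_S ib) (ev_S v) (ev_S v').
apply: bound2_ext (bound2_add IH H) => x.
by rewrite [lift_coord ((ib :: v) ++ v')]/= [lift_coord (ib :: v)]/= ev_cat ev_cons; ring.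
Qed.

Lemma lift_coord_red i b v :
  bound2 (fun x => lift_coord ((i, b) :: (i, ~~ b) :: v) x - lift_coord v x).
Proof.
have H := sg_cocycle (letter_S (i, b)) (letter_S (i, ~~ b)) (ev_S v).
rewrite letter_inv in H; have H1 := sg_1l (ev_S v).
have {H H1} H := bound2_add H H1; move: H; case: b => H.
  have Sx := nth_gens i; have := sg_cocycle Sx (SV Sx) Sx; rewrite mulV // mulVl //.
  move=> H2; have H3 := bound2_sub (sg_1l Sx) (sg_1r Sx).
  apply: bound2_ext (bound2_add H (bound2_add H2 H3)) => x /=.
  by rewrite /letter /=; ring.
by apply: bound2_ext H => x /=; rewrite /letter /=; ring.
Qed.

Hypothesis lift_rels : forall r, r \in rels -> bound2 (lift_coord r).

Lemma lift_coord_equiv v v' : pres_equiv rels v v' ->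
  ev v = ev v' /\ bound2 (fun x => lift_coord v x - lift_coord v' x).
Proof.
elim=> [{}v {}v' H|{}v|{}v {}v' _ [E H]|v1 v2 v3 _ [E1 H1] _ [E2 H2]].
- have prefix u y y' : ev y = ev y' -> bound2 (fun x => lift_coord y x - lift_coord y' x) ->
      ev (u ++ y) = ev (u ++ y') /\
      bound2 (fun x => lift_coord (u ++ y) x - lift_coord (u ++ y') x).
    move=> E B; split; first by rewrite !ev_cat E.
    have := bound2_sub (lift_coord_cat u y) (lift_coord_cat u y'); rewrite E => C.
    by apply: bound2_ext (bound2_add C B) => x; ring.
  case: H => [u y i b|u y r rr]; apply: prefix.
  + by rewrite !ev_cons mulA letter_inv one_l.
  + exact: lift_coord_red.
  + by rewrite ev_cat ev_rels // one_l.
  + have := bound2_add (lift_coord_cat r y) (bound2_add (lift_rels rr) (sg_1l (ev_S y))).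
    by rewrite ev_rels //; apply: bound2_ext => x; ring.
- by split=> //; apply: bound2_ext bound2_0 => x; rewrite subrr.
- by split=> //; apply: bound2_ext (bound2_scale (-1) H) => x; ring.
- by split; [rewrite E1|apply: bound2_ext (bound2_add H1 H2) => x; ring].
Qed.

Hypothesis ev_surj :
  forall g, S g -> exists v, word_in (size gens) v /\ ev v = g.
Hypothesis ev_equiv : forall v, word_in (size gens) v ->
  ev v = one -> pres_equiv rels v [::].

(** The hypothesis [ev_equiv] speaks of words with value [one]; appending to both words the same
    word [v2] for the inverse reduces to that case. *)
Lemma lift_coord_ev v v' : word_in (size gens) v -> word_in (size gens) v' ->
  ev v = ev v' -> bound2 (fun x => lift_coord v x - lift_coord v' x).
Proof.
move=> Wv Wv' E; have [v2 [W2 E2]] := ev_surj (SV (ev_S v)).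
have triv y : word_in (size gens) y -> ev y = ev v -> bound2 (lift_coord (y ++ v2)).
  move=> Wy Ey; have [] := @lift_coord_equiv (y ++ v2) [::].
    apply: ev_equiv; first by rewrite /word_in all_cat; apply/andP.
    by rewrite ev_cat Ey E2 mulV //; exact: ev_S.
  by move=> _; apply: bound2_ext => x /=; rewrite subr0.
have H1 := bound2_sub (triv v Wv erefl) (lift_coord_cat v v2).
have := bound2_sub (triv v' Wv' (esym E)) (lift_coord_cat v' v2); rewrite -E => H2.
by apply: bound2_ext (bound2_sub H1 H2) => x; ring.
Qed.

(** The coordinate of a chosen word for [g], with its sign changed, is a cochain whose coboundary is
    the tautological cocycle. The summand [[1|1]] undoes the normalization of [sg]. *)
Lemma cocycle_splits : exists F : T -> seq T -> K, forall g h, S g -> S h ->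
  bound2 (fun x => basis [:: g; h] x - (F h x - F (mul g h) x + F g x)).
Proof.
have /choice [wd Hwd] : forall g, exists v, S g -> word_in (size gens) v /\ ev v = g.
  move=> g; case: (pselect (S g)) => [/ev_surj [v Hv]|nS]; first by exists v.
  by exists [::].
exists (fun g x => basis [:: one; one] x - lift_coord (wd g) x) => g h Sg Sh.
have [Wg Eg] := Hwd g Sg; have [Wh Eh] := Hwd h Sh.
have [Wgh Egh] := Hwd _ (SM Sg Sh).
have C := lift_coord_cat (wd g) (wd h).
have L : bound2 (fun x => lift_coord (wd g ++ wd h) x - lift_coord (wd (mul g h)) x).
  apply: lift_coord_ev => //; first by rewrite /word_in all_cat; apply/andP.
  by rewrite ev_cat Eg Eh Egh.
rewrite Eg Eh in C.
by apply: bound2_ext (bound2_sub L C) => x; rewrite /sg; ring.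
Qed.

End Splitting.

(** Other lifts of the generators change the coordinate of a word through its exponent sums alone.
    Killing the relators is thus a linear system whose matrix is the exponent matrix. *)
Lemma lift_coord_shift l v x :
  lift_coord l v x = lift_coord (fun _ _ => 0) v x + letter_sum l v x.
Proof.
elim: v => [|[i b] v IH]; first by rewrite /letter_sum big_nil addr0.
by rewrite /letter_sum big_cons /= -/(letter_sum l v x) IH; case: b; ring.
Qed.

End Words.

(** A tuple may occur several times in the list, so the induction removes all its occurrences at
    once. *)
Lemma sum_chain_eq0 (F : seq T -> K) c :
  (forall x, coeff c x = 0) -> \sum_(p <- c) p.1 * F p.2 = 0.
Proof.
have [n] := ubnP (size c); elim: n c => // n IH [|[a y] c]; rewrite ?big_nil // ltnS => lt H.
pose c1 := (a, y) :: c.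
rewrite (bigID (fun p => `[< p.2 = y >])) /=.
have -> : \sum_(p <- (a, y) :: c | `[< p.2 = y >]) p.1 * F p.2 = coeff c1 y * F y.
  by rewrite /coeff mulr_suml; apply: eq_bigr => p /asboolP ->.
rewrite H mul0r add0r -big_filter; apply: IH.
  rewrite /= asboolT //=; apply: leq_ltn_trans lt.
  by rewrite size_filter; exact: count_size.
move=> x; rewrite /coeff big_filter_cond.
case: (pselect (y = x)) => [<-|ne].
  by rewrite big1 // => p /andP [/negP].
rewrite -[RHS](H x) /coeff; apply: eq_bigl => p.
case: (pselect (p.2 = x)) => [E|E]; last by rewrite (asboolF E) andbF.
rewrite (asboolT E) andbT; apply/negP => /asboolP; by rewrite E => /esym.
Qed.

Lemma bound2_sum c (F : seq T -> seq T -> K) : (forall p, List.In p c -> bound2 (F p.2)) ->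
  bound2 (fun x => \sum_(p <- c) p.1 * F p.2 x).
Proof.
elim: c => [|p c IH] H.
  by apply: bound2_ext bound2_0 => x; rewrite big_nil.
have Hp := bound2_scale p.1 (H p (or_introl erefl)).
apply: bound2_ext (bound2_add Hp (IH (fun q qc => H q (or_intror qc)))) => x.
by rewrite big_cons.
Qed.

Lemma coeff_sum c x : coeff c x = \sum_(p <- c) p.1 * basis p.2 x.
Proof.
elim: c => [|[a y] c IH]; first by rewrite coeff_nil big_nil.
by rewrite coeff_cons big_cons IH.
Qed.

(** Replacing each [[g|h]] by the coboundary of [F] changes [c] by a boundary, and the coboundaries
    add up to [F] evaluated on [bd2 c], which is 0 for a cycle. *)
Lemma H2_zero_splitting (F : T -> seq T -> K) : (forall g h, S g -> S h ->
    bound2 (fun x => basis [:: g; h] x - (F h x - F (mul g h) x + F g x))) ->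
  H2_zero mul S K.
Proof.
move=> HF c Hc Zc.
pose D y x : K := if y is [:: g; h] then F h x - F (mul g h) x + F g x else 0.
pose F1 x y : K := if y is [:: g] then F g x else 0.
have B : bound2 (fun x => \sum_(p <- c) p.1 * (basis p.2 x - D p.2 x)).
  apply: (bound2_sum (F := fun y x => basis y x - D y x)) => -[a y] /Hc [] /=.
  case: y => [|g [|h [|? ?]]] //= _ Sgh; apply: HF; apply: Sgh; by [left|right; left].
have Z x : \sum_(p <- c) p.1 * D p.2 x = 0.
  rewrite -[RHS](@sum_chain_eq0 (F1 x) (bd2 c)); last by move=> y; rewrite Zc coeff_nil.
  rewrite /Defs.bd2 big_flatten big_map /=; apply: eq_bigr => -[a y] _.
  case: y => [|g [|h [|? ?]]]; rewrite /bd2_term /= ?big_nil ?mulr0 //.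
  by rewrite !big_cons big_nil /=; ring.
have [d Hd Ed] := B; exists d; split=> // x; rewrite -Ed coeff_sum.
by under eq_bigr do rewrite mulrBr; rewrite sumrB Z subr0.
Qed.

End Homology.

Lemma H1_finite_cyclic (T : Type) (mul : T -> T -> T) (S : T -> Prop) (t : T) (M : nat) :
  S t -> (0 < M)%N -> bound1 mul S (fun x => M%:Z * basis int [:: t] x) ->
  (forall g, S g -> exists k : int,
     bound1 mul S (fun x => basis int [:: g] x - k * basis int [:: t] x)) ->
  H1_finite mul S int.
Proof.
move=> St M0 HM Hg.
exists [seq [:: ((r%:Z : int), [:: t])] | r <- iota 0 M]; split.
  by move=> e /List.in_map_iff [r [<- _]] p [<-|[]] /=; split=> // g [<-|[]].
move=> c Hc.
have [k Hk] : exists k : int, bound1 mul S (fun x => coeff c x - k * basis int [:: t] x).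
  elim: c Hc => [|[a y] c IH] Hc.
    by exists 0; apply: bound1_ext (bound1_0 _ _ _) => x; rewrite coeff_nil; ring.
  have [k1 H1] := IH (fun p pc => Hc p (or_intror pc)).
  have [] := Hc (a, y) (or_introl erefl); case: y {Hc} => [|g [|? ?]] //= _ Sg.
  have [k2 H2] := Hg g (Sg g (or_introl erefl)).
  exists (a * k2 + k1).
  apply: bound1_ext (bound1_add (bound1_scale a H2) H1) => x; rewrite coeff_cons; ring.
pose r := `|(k %% M%:Z)%Z|%N.
have M0' : M%:Z != 0 by lia.
have Er : r%:Z = (k %% M%:Z)%Z by rewrite gez0_abs // modz_ge0.
have [d Hd Ed] := bound1_add Hk (bound1_scale (k %/ M%:Z)%Z HM).
exists [:: (r%:Z, [:: t])], d; split; last split=> //.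
  apply/List.in_map_iff; exists r; split=> //.
  have : (r < M)%N by have := ltz_pmod k (_ : 0 < M%:Z); lia.
  move=> rM; have : r \in iota 0 M by rewrite mem_iota.
  elim: (iota 0 M) => //= a s IH; rewrite inE => /orP [/eqP ->|/IH]; by [left|right].
move=> x; rewrite coeff_cat -Ed coeff_cons coeff_nil Er.
have H (k' q r' m b a : int) : k' = q * m + r' ->
  a = r' * b + 0 + (a - k' * b + q * (m * b)) by move=> ->; ring.
exact: H (divz_eq k M%:Z).
Qed.

(** * The universal cover as a group of lifts *)

Section UniversalCover.
Variable R : realType.
Local Notation cov := (cov R).
Implicit Types (A B : 'M[R]_2) (f g : R -> R) (x y : cov) (t : R).

Lemma cos_eq1_small t : cos t = 1 -> `|t| < pi *+ 2 -> t = 0.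
Proof.
have pos (v : R) : 0 < v -> v < pi *+ 2 -> cos v = 1 -> False.
  move=> v0 v2 cv; have vE : (v / 2) *+ 2 = v by rewrite mulr2n; lra.
  have s0 : 0 < sin (v / 2).
    by apply: sin_gt0_pi; apply/andP; split; move: v2; rewrite mulr2n; lra.
  have := cos_mulr2n (v / 2); rewrite vE cv cos2sin2 mulr2n => E.
  have /eqP : sin (v / 2) ^+ 2 = 0 by lra.
  by rewrite sqrf_eq0 gt_eqF.
move=> ct lt; case: (ltrgtP t 0) => // t0; exfalso.
  by apply: (pos (- t)); rewrite ?cosN ?oppr_gt0 //; move: lt; rewrite ltr0_norm.
by apply: (pos t) => //; move: lt; rewrite gtr0_norm.
Qed.

Lemma lifts_cos A f g t : lifts A f -> lifts A g -> cos (f t - g t) = 1.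
Proof.
move=> /(_ t) [r [r0 [E1 E2]]] /(_ t) [r' [r0' [E1' E2']]].
rewrite {}E1 in E1'; rewrite {}E2 in E2'.
have rr : r = r'.
  have : r ^+ 2 = r' ^+ 2.
    have H1 := cos2Dsin2 (f t); have H2 := cos2Dsin2 (g t).
    have -> : r ^+ 2 = (r * cos (f t)) ^+ 2 + (r * sin (f t)) ^+ 2.
      by rewrite !exprMn -mulrDr H1 mulr1.
    by rewrite E1' E2' !exprMn -mulrDr H2 mulr1.
  by move/eqP; rewrite eqrXn2 ?ltW // => /eqP.
rewrite -rr in E1' E2'.
have {E1'}c : cos (f t) = cos (g t) by apply: (mulfI _ E1'); rewrite gt_eqF.
have {E2'}s : sin (f t) = sin (g t) by apply: (mulfI _ E2'); rewrite gt_eqF.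
by rewrite cosB c s -!expr2 cos2Dsin2.
Qed.

(** The values of [h] are multiples of 2 pi; if one were nonzero, the intermediate value theorem
    would give [|h|] a value in (0, pi]. *)
Lemma continuous_cos1 (h : R -> R) t0 : continuous h -> (forall t, cos (h t) = 1) ->
  h t0 = 0 -> forall t, h t = 0.
Proof.
move=> ch ch1 h0 t; apply/eqP/negPn/negP => ht.
have p0 : 0 < (pi : R) := pi_gt0 R.
pose v := Num.min `|h t| pi.
have v0 : 0 < v by rewrite lt_min normr_gt0 ht.
have vpi : v <= pi by rewrite ge_min lexx orbT.
have vh : v <= `|h t| by rewrite ge_min lexx.
have [c Hc] : exists c, `|h c| = v.
  have cn : continuous (fun s => `|h s|).
    by move=> s; apply: (@continuous_comp _ _ _ h (fun z => `|z|)); [exact: ch|exact: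
        norm_continuous].
  case: (lerP t0 t) => tt.
    have [|c _ E] := @IVT _ (fun s => `|h s|) t0 t v tt (continuous_subspaceT cn).
      rewrite h0 normr0 min_l ?max_r ?normr_ge0 //; by rewrite ltW.
    by exists c.
  have [|c _ E] := @IVT _ (fun s => `|h s|) t t0 v (ltW tt) (continuous_subspaceT cn).
    rewrite h0 normr0 min_r ?max_l ?normr_ge0 //; by rewrite ltW.
  by exists c.
have := cos_eq1_small (ch1 c); rewrite Hc => /(_ _) E.
have Z : h c = 0 by apply: E; apply: le_lt_trans vpi _; rewrite mulr2n; lra.
by move: v0; rewrite -Hc Z normr0 ltxx.
Qed.

(** Two lifts of one matrix differ by a constant multiple of 2 pi. An identity in the cover thus
    reduces to a matrix identity and an estimate at a single angle. *)
Lemma cov_ext x y t : in_cover x -> in_cover y -> x.1 = y.1 ->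
  `|x.2.1 t - y.2.1 t| < pi *+ 2 -> x = y.
Proof.
case: x => A [f f']; case: y => B [g g'] [_ [/= cf [fK [fK' lf]]]] [_ [/= cg [gK [gK' lg]]]].
move=> AB; subst B => lt.
have E0 : f t - g t = 0 by apply: cos_eq1_small lt; exact: lifts_cos lf lg.
have fg : f = g.
  apply/funext => s; apply/eqP; rewrite -subr_eq0; apply/eqP.
  apply: (@continuous_cos1 (fun s => f s - g s) t) => // [v|v].
    by apply: continuousB; [exact: cf|exact: cg].
  exact: lifts_cos lf lg.
subst g; suff -> : f' = g' by [].
by apply/funext => s; rewrite -[in LHS](gK' s) fK.
Qed.

Lemma invmx2 A : \det A = 1 ->
  invmx A = mx2 (A ord_max ord_max) (- A ord0 ord_max) (- A ord_max ord0) (A ord0 ord0).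
Proof.
move=> dA; have U : A \in unitmx by rewrite unitmxE dA unitr1.
rewrite -[RHS]mul1mx -(mulVmx U) -mulmxA.
suff -> : A *m mx2 (A ord_max ord_max) (- A ord0 ord_max) (- A ord_max ord0) (A ord0 ord0) = 1%:M.
  by rewrite mulmx1.
rewrite det_mx2E in dA.
apply: mx2_ext; rewrite mulmx2 !mxE /= ?mulr1n ?mulr0n; [rewrite -dA|..|rewrite -dA]; ring.
Qed.

Lemma lifts_comp A B f g : lifts A f -> lifts B g -> lifts (A *m B) (f \o g).
Proof.
move=> lf lg t; have [r [r0 [E1 E2]]] := lg t; have [r' [r0' [E1' E2']]] := lf (g t).
exists (r * r'); split; first exact: mulr_gt0.
rewrite !mulmx2 /= -!mulrA -E1' -E2' !mulrDr ![r * (_ * _)]mulrCA -E1 -E2.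
by split; ring.
Qed.

Lemma lifts_id : lifts (1%:M : 'M[R]_2) id.
Proof. by move=> t; exists 1; rewrite !mxE /= !mul1r !mul0r addr0 add0r. Qed.

Lemma in_cover_one : in_cover (cov_one R).
Proof.
split; first by rewrite det1.
by split; [move=> t; exact: cvg_id|split=> //; split=> //; exact: lifts_id].
Qed.

Lemma in_cover_mul x y : in_cover x -> in_cover y -> in_cover (cov_mul x y).
Proof.
move=> [d1 [c1 [k1 [k1' l1]]]] [d2 [c2 [k2 [k2' l2]]]]; split.
  by rewrite det_mulmx d1 d2 mulr1.
split; first by move=> t; apply: continuous_comp; [exact: c2|exact: c1].
split; first by move=> t /=; rewrite k1 k2.
by split; [move=> t /=; rewrite k2' k1'|exact: lifts_comp].
Qed.

Lemma in_cover_inv x : in_cover x -> in_cover (cov_inv x).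
Proof.
case: x => A [f f'] [/= dA [/= cf [fK [fK' lf]]]]; split=> /=.
  by rewrite invmx2 // det_mx2E !mxE /= -[RHS]dA det_mx2E; ring.
split.
  move=> t; have : {near f (f' t), continuous f'}.
    apply: (@near_can_continuous _ f f' (f' t)).
      by apply: filterE => y; exact: fK.
    by apply: filterE => y; exact: cf.
  by move/nbhs_singleton; rewrite fK'.
split=> //; split=> // t; have [r [r0 [E1 E2]]] := lf (f' t).
exists r^-1; split; first by rewrite invr_gt0.
rewrite fK' in E1 E2.
have Ec : cos t = r^-1 * (r * cos t) by rewrite mulKf // gt_eqF.
have Es : sin t = r^-1 * (r * sin t) by rewrite mulKf // gt_eqF.
rewrite invmx2 // !mxE /= Ec Es -E1 -E2.
move: dA; rewrite det_mx2E => dA.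
split.
  transitivity (r^-1 * ((A ord0 ord0 * A ord_max ord_max - A ord0 ord_max * A ord_max ord0)
      * cos (f' t))); first by ring.
  by rewrite dA mul1r.
transitivity (r^-1 * ((A ord0 ord0 * A ord_max ord_max - A ord0 ord_max * A ord_max ord0) *
    sin (f' t))); first by ring.
by rewrite dA mul1r.
Qed.

Lemma cov_mulA : associative (@cov_mul R).
Proof. by move=> x y z; rewrite /cov_mul /= mulmxA. Qed.

Lemma cov_mul1l : left_id (cov_one R) (@cov_mul R).
Proof. by case=> A [f f']; rewrite /cov_mul /= mul1mx. Qed.

Lemma cov_mul1r : right_id (cov_one R) (@cov_mul R).
Proof. by case=> A [f f']; rewrite /cov_mul /= mulmx1. Qed.

Lemma cov_mulV x : in_cover x -> cov_mul x (cov_inv x) = cov_one R.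
Proof.
case: x => A [f f'] [/= dA [_ [fK [fK' _]]]].
rewrite /cov_mul /cov_one /= mulmxV ?unitmxE ?dA ?unitr1 //.
by congr (_, (_, _)); apply/funext => t /=; rewrite ?fK ?fK'.
Qed.

Lemma cov_mulVl x : in_cover x -> cov_mul (cov_inv x) x = cov_one R.
Proof.
case: x => A [f f'] [/= dA [_ [fK [fK' _]]]].
rewrite /cov_mul /cov_one /= mulVmx ?unitmxE ?dA ?unitr1 //.
by congr (_, (_, _)); apply/funext => t /=; rewrite ?fK ?fK'.
Qed.

Lemma Gamma_one : Gamma_tilde (cov_one R).
Proof.
split; first exact: in_cover_one.
by move=> i j; rewrite mxE; case: eqP => _; [exact: (dyadic_int R 1)|exact: dyadic0].
Qed.

Lemma Gamma_mul x y : Gamma_tilde x -> Gamma_tilde y -> Gamma_tilde (cov_mul x y).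
Proof.
move=> [Cx Dx] [Cy Dy]; split; first exact: in_cover_mul.
by move=> i j; rewrite mulmx2; apply: dyadicD; apply: dyadicM.
Qed.

Lemma Gamma_inv x : Gamma_tilde x -> Gamma_tilde (cov_inv x).
Proof.
move=> [Cx Dx]; split; first exact: in_cover_inv.
case: (Cx) => dx _; move=> i j; rewrite /= invmx2 // mxE.
by case: ifP => _; case: ifP => _ //; exact: dyadicN.
Qed.

(** For the unit vector v at angle [t], this is the inner product of v with A v, and [ccross] is the
    determinant of (v, A v); the quotient [ccross / cdot] is the tangent of the angle from v to A
    v. *)
Definition cdot A t := (A ord0 ord0 * cos t + A ord0 ord_max * sin t) * cos t
                     + (A ord_max ord0 * cos t + A ord_max ord_max * sin t) * sin t.
Definition ccross A t := (A ord_max ord0 * cos t + A ord_max ord_max * sin t) * cos t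
                       - (A ord0 ord0 * cos t + A ord0 ord_max * sin t) * sin t.

(* If [A] turns every vector by less than a right angle, the turning angle
   itself defines a lift. *)
Definition turn A t := t + atan (ccross A t / cdot A t).

Lemma turn_bound A t : `|turn A t - t| < pi / 2.
Proof. by rewrite /turn addrC addKr ltr_norml atan_gtNpi2 atan_ltpi2. Qed.

Lemma turn_fixed A t : ccross A t = 0 -> turn A t = t.
Proof. by rewrite /turn => ->; rewrite mul0r atan0 addr0. Qed.

Lemma turn_lifts A : (forall t, 0 < cdot A t) -> lifts A (turn A).
Proof.
move=> pA t; set a := atan (ccross A t / cdot A t).
have ca : 0 < cos a by apply: cos_gt0_pihalf; rewrite atan_gtNpi2 atan_ltpi2.
exists (cdot A t / cos a); split; first exact: divr_gt0.
have cr : ccross A t = cdot A t / cos a * sin a.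
  have : tan a = ccross A t / cdot A t by rewrite atanK.
  rewrite /tan => E; rewrite mulrAC -mulrA E mulrC mulfVK ?gt_eqF //.
have E1 : cdot A t / cos a * cos a = cdot A t by rewrite mulfVK ?gt_eqF.
rewrite /turn -/a cosD sinD !mulrBr !mulrDr.
rewrite (mulrCA (cdot A t / cos a) (cos t)) (mulrCA (cdot A t / cos a) (sin t)).
rewrite (mulrCA (cdot A t / cos a) (sin t) (cos a)) (mulrCA (cdot A t / cos a) (cos t) (sin a)).
rewrite E1 -cr /cdot /ccross.
have H := cos2Dsin2 t; split.
  transitivity ((A ord0 ord0 * cos t + A ord0 ord_max * sin t) * (cos t ^+ 2 + sin t ^+ 2)).
    by rewrite H mulr1.
  by ring.
transitivity ((A ord_max ord0 * cos t + A ord_max ord_max * sin t) * (cos t ^+ 2 + sin t ^+ 2)).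
  by rewrite H mulr1.
by ring.
Qed.

Lemma turn_continuous A : (forall t, 0 < cdot A t) -> continuous (turn A).
Proof.
move=> pA t; rewrite /turn; apply: continuousD; first exact: cvg_id.
have cc := @continuous_cos R; have cs := @continuous_sin R.
apply: (@continuous_comp _ _ _ (fun t => ccross A t / cdot A t) (@atan R)); last exact:
    continuous_atan.
have lin (a b : R) : {for t, continuous (fun t => a * cos t + b * sin t)}.
  by apply: continuousD; apply: continuousM => //; (exact: cst_continuous || exact: cc ||
      exact: cs).
apply: continuousM.
  by apply: continuousB; apply: continuousM; (exact: lin || exact: cc || exact: cs).
apply: continuousV; first by rewrite gt_eqF.
by apply: continuousD; apply: continuousM; (exact: lin || exact: cc || exact: cs).
Qed.

(** With J the rotation by a right angle, determinant 1 gives A^-1 = J^-1 A^T J, so the inner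
    product for the inverse at [t] is that for [A] at [t + pi / 2]. *)
Lemma cdot_inv A : \det A = 1 -> (forall t, 0 < cdot A t) -> forall t, 0 < cdot (invmx A) t.
Proof.
move=> dA pA t; have := pA (t + pi / 2); rewrite invmx2 // /cdot cosDpihalf sinDpihalf !mxE /=.
set l := (X in 0 < X -> _); set r := (X in _ -> 0 < X).
by have -> : l = r by rewrite /l /r; ring.
Qed.

Definition turn_cov A : cov := (A, (turn A, turn (invmx A))).

(** The composite lifts the identity and moves each angle by less than pi. *)
Lemma turn_cancel A B : (forall t, 0 < cdot A t) -> (forall t, 0 < cdot B t) ->
  A *m B = 1%:M -> cancel (turn B) (turn A).
Proof.
move=> pA pB AB t.
have L : lifts 1%:M (turn A \o turn B).
  by rewrite -AB; apply: lifts_comp; apply: turn_lifts.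
have C := lifts_cos t L lifts_id.
apply/eqP; rewrite -subr_eq0; apply/eqP/(cos_eq1_small C) => /=.
have H1 := turn_bound A (turn B t); have H2 := turn_bound B t.
have p0 := pi_gt0 R.
have := ler_normD (turn A (turn B t) - turn B t) (turn B t - t).
by rewrite subrKA mulr2n; lra.
Qed.

Lemma turn_in_cover A : \det A = 1 -> (forall t, 0 < cdot A t) -> in_cover (turn_cov A).
Proof.
move=> dA pA; have pA' := cdot_inv dA pA.
have U : A \in unitmx by rewrite unitmxE dA unitr1.
split=> //; split; first exact: turn_continuous.
split; first by apply: turn_cancel => //; rewrite mulVmx.
by split; [apply: turn_cancel => //; rewrite mulmxV|exact: turn_lifts].
Qed.


(** * The generators inside the cover *)

Definition cov_w : cov := (mx2 0 (-1) 1 0, (fun t => t + pi / 2, fun t => t - pi / 2)).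

Lemma cov_w_in : in_cover cov_w.
Proof.
split; first by rewrite det_mx2E !mxE /=; ring.
split.
  have c : continuous (fun t : R => t + pi / 2).
    by move=> t; apply: cvgD; [exact: cvg_id|exact: cvg_cst].
  exact: c.
split; first by move=> t /=; rewrite addrK.
split; first by move=> t /=; rewrite subrK.
move=> t; exists 1; split=> //; rewrite !mxE /= cosDpihalf sinDpihalf; split; ring.
Qed.

Definition cov_t : cov := turn_cov (mx2 1 1 0 1).

Lemma cov_t_in : in_cover cov_t.
Proof.
apply: turn_in_cover; first by rewrite det_mx2E !mxE /=; ring.
move=> t; rewrite /cdot !mxE /=; have := cos2Dsin2 t.
by move: (cos t) (sin t) => c s; nra.
Qed.

(** An element with irrational entries, used to define [cov_s] and to carry the first relator over
    to the second. *)
Definition cov_q : cov := turn_cov (mx2 (Num.sqrt 2) 0 0 (Num.sqrt 2)^-1).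

Lemma sqrt2_gt0 : 0 < Num.sqrt (2 : R).
Proof. by rewrite sqrtr_gt0. Qed.

Lemma cov_q_det : \det (mx2 (Num.sqrt 2) 0 0 (Num.sqrt 2)^-1 : 'M[R]_2) = 1.
Proof. by rewrite det_mx2E !mxE /= mulr0 subr0 divff // gt_eqF // sqrt2_gt0. Qed.

Lemma cov_q_in : in_cover cov_q.
Proof.
apply: turn_in_cover cov_q_det _ => t.
rewrite /cdot !mxE /= !mul0r addr0 add0r -!mulrA -!expr2.
have q0 := sqrt2_gt0; have q1 : 0 < (Num.sqrt (2 : R))^-1 by rewrite invr_gt0.
have := cos2Dsin2 t; move: (cos t) (sin t) (Num.sqrt _) (_^-1) q0 q1 => c s a b a0 b0 E.
have [c0|c0] := eqVneq c 0.
  by move: E; rewrite c0 expr0n add0r => ->; rewrite mulr0 add0r mulr1.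
apply: ltr_pwDl; first by rewrite mulr_gt0 // exprn_even_gt0.
by rewrite mulr_ge0 ?sqr_ge0 // ltW.
Qed.

Definition cov_s : cov := cov_mul (cov_mul cov_q cov_w) (cov_inv cov_q).

Lemma cov_s_in : in_cover cov_s.
Proof.
apply: in_cover_mul; last exact: in_cover_inv cov_q_in.
exact: in_cover_mul cov_q_in cov_w_in.
Qed.

Lemma cov_s_mx : cov_s.1 = mx2 0 (-2) 2^-1 0.
Proof.
rewrite /= invmx2 ?cov_q_det // !mul_mx2 !mxE /=.
have q0 : Num.sqrt (2 : R) != 0 by rewrite gt_eqF // sqrt2_gt0.
have q2 : Num.sqrt (2 : R) * Num.sqrt 2 = 2 by rewrite -expr2 sqr_sqrtr.
move: (Num.sqrt 2) q0 q2 => q q0 q2; congr mx2.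
- by ring.
- by rewrite -q2; ring.
- by rewrite -q2; field.
- by ring.
Qed.

Lemma turn_q_axes t : cos t = 0 \/ sin t = 0 ->
  cov_q.2.1 t = t /\ cov_q.2.2 t = t.
Proof.
move=> H; have cs : cos t * sin t = 0 by case: H => ->; rewrite ?mulr0 ?mul0r.
split; apply: turn_fixed; rewrite ?invmx2 ?cov_q_det // /ccross !mxE /=.
  transitivity (((Num.sqrt 2)^-1 - Num.sqrt 2) * (cos t * sin t)); first by ring.
  by rewrite cs mulr0.
transitivity ((Num.sqrt 2 - (Num.sqrt 2)^-1) * (cos t * sin t)); first by ring.
by rewrite cs mulr0.
Qed.

Lemma turn_t_axis t : sin t = 0 -> cov_t.2.1 t = t /\ cov_t.2.2 t = t.
Proof.
move=> H; split; apply: turn_fixed; rewrite ?invmx2 ?det_mx2E /ccross !mxE /= ?H; ring.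
Qed.

Lemma cov_one_small x t : in_cover x -> x.1 = 1%:M -> `|x.2.1 t - t| < pi *+ 2 ->
  x = cov_one R.
Proof. by move=> Cx E lt; apply: (cov_ext (t := t)) => //; exact: in_cover_one. Qed.

Lemma cov_qt : cov_mul (cov_mul cov_q cov_t) (cov_inv cov_q) = cov_mul cov_t cov_t.
Proof.
apply: (cov_ext (t := 0)).
- apply: in_cover_mul; last exact: in_cover_inv cov_q_in.
  exact: in_cover_mul cov_q_in cov_t_in.
- exact: in_cover_mul cov_t_in cov_t_in.
- rewrite /= invmx2 ?cov_q_det // !mul_mx2 !mxE /=.
  have q0 : Num.sqrt (2 : R) != 0 by rewrite gt_eqF // sqrt2_gt0.
  have q2 : Num.sqrt (2 : R) * Num.sqrt 2 = 2 by rewrite -expr2 sqr_sqrtr.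
  move: (Num.sqrt 2) q0 q2 => q q0 q2; congr mx2.
  + by field.
  + by transitivity (q * q); [ring|rewrite q2; ring].
  + by ring.
  + by field.
have [q1 q1'] := @turn_q_axes 0 (or_intror (sin0 R)).
have [t1 _] := @turn_t_axis 0 (sin0 R).
rewrite /= in q1 q1' t1 *; rewrite q1' t1 q1 t1 subrr normr0 mulr2n.
by have := pi_gt0 R; lra.
Qed.

End UniversalCover.

(** * The relators hold in the cover *)

Section CoverRelations.
Variable R : realType.

Definition cov_gens : seq (cov R) := [:: cov_w R; cov_t R; cov_s R].
Local Notation ev := (eval_word (@cov_mul R) (cov_one R) (@cov_inv R) cov_gens).

(* Generators [0], [1], [2] are [w], [t], [s]: a rotation by a right angle, the
   elementary unipotent, and the conjugate of [w] by [diag (sqrt 2) (1 / sqrt 2)]. *)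
Definition rel_wt : word :=
  [:: (0, false); (1, false); (0, false); (1, false); (0, false); (1, false);
      (0, true); (0, true)]%N.
Definition rel_stt : word :=
  [:: (2, false); (1, false); (1, false); (2, false); (1, false); (1, false);
      (2, false); (1, false); (1, false); (2, true); (2, true)]%N.
Definition rel_wst : word :=
  [:: (0, false); (1, false); (0, true);
      (2, false); (1, true); (1, true); (1, true); (1, true); (2, true)]%N.
Definition gamma_rels : seq word := [:: rel_wt; rel_stt; rel_wst].

Lemma cov_gens_Gamma g : List.In g cov_gens -> Gamma_tilde g.
Proof.
have d0 := dyadic0 R; have d1 := dyadic_int R 1.
have dmx2 (a b c d : R) : dyadic a -> dyadic b -> dyadic c -> dyadic d ->
    forall i j, dyadic (mx2 a b c d i j).
  by move=> *; rewrite mxE; case: ifP; case: ifP.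
case=> [<-|[<-|[<-|[]]]].
- split; [exact: cov_w_in|apply: dmx2 => //; exact: dyadicN].
- by split; [exact: cov_t_in|apply: dmx2].
- split; first exact: cov_s_in.
  rewrite cov_s_mx; apply: dmx2 => //.
    exact/dyadicN/(dyadic_int R 2).
  exact: (dyadic_pow2 R (-1)).
Qed.

Lemma cov_gens_in g : List.In g cov_gens -> in_cover g.
Proof. by case/cov_gens_Gamma. Qed.

Lemma ev_in_cover v : in_cover (ev v).
Proof.
apply: ev_S; [exact: in_cover_one|exact: in_cover_mul|exact: in_cover_inv|exact: cov_gens_in].
Qed.

Local Notation W := (mx2 0 (-1) 1 0 : 'M[R]_2).
Local Notation U := (mx2 1 1 0 1 : 'M[R]_2).

Lemma cov_wV_mx : (cov_inv (cov_w R)).1 = mx2 0 1 (-1) 0.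
Proof.
by rewrite /= invmx2 ?det_mx2E !mxE /= ?opprK; [congr mx2; ring|ring].
Qed.

Lemma cov_tV_mx : (cov_inv (cov_t R)).1 = mx2 1 (-1) 0 1.
Proof. by rewrite /= invmx2 ?det_mx2E !mxE /=; [congr mx2; ring|ring]. Qed.

Lemma cov_sV_mx : (cov_inv (cov_s R)).1 = mx2 0 2 (- 2^-1) 0.
Proof.
have [d _] := cov_s_in R.
by rewrite -[LHS]/(invmx (cov_s R).1) invmx2 // cov_s_mx !mxE /=; congr mx2; ring.
Qed.

Definition quarter_turn : R -> R := fun y => y + pi / 2.
Definition quarter_turnV : R -> R := fun y => y - pi / 2.
Local Notation ft := (turn U).
Local Notation ft' := (turn (invmx U)).
Definition turn_q := (cov_q R).2.1.
Definition turn_qV := (cov_q R).2.2.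

Lemma ev_nilE y : (ev [::]).2.1 y = y. Proof. by []. Qed.
Lemma ev_wE v y : (ev ((0, false) :: v)%N).2.1 y = quarter_turn ((ev v).2.1 y). Proof. by []. Qed.
Lemma ev_wVE v y : (ev ((0, true) :: v)%N).2.1 y = quarter_turnV ((ev v).2.1 y). Proof. by []. Qed.
Lemma ev_tE v y : (ev ((1, false) :: v)%N).2.1 y = ft ((ev v).2.1 y). Proof. by []. Qed.
Lemma ev_tVE v y : (ev ((1, true) :: v)%N).2.1 y = ft' ((ev v).2.1 y). Proof. by []. Qed.
Lemma ev_sE v y : (ev ((2, false) :: v)%N).2.1 y = turn_q (quarter_turn (turn_qV ((ev v).2.1 y))).
Proof. by []. Qed.
Lemma ev_sVE v y : (ev ((2, true) :: v)%N).2.1 y = turn_q (quarter_turnV (turn_qV ((ev v).2.1 y))).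
Proof. by []. Qed.

Definition evE := (ev_nilE, ev_wE, ev_wVE, ev_tE, ev_tVE, ev_sE, ev_sVE).

Lemma ev_rel_wt : ev rel_wt = cov_one R.
Proof.
(* From pi the two inverse quarter turns lead to 0, which [t] fixes. The two remaining shears move
   an angle by less than pi / 2 each, so the total displacement stays below 2 pi. *)
apply: (cov_one_small (t := pi)); first exact: ev_in_cover.
  rewrite -[LHS]/(W *m (U *m (W *m (U *m (W *m (U *m ((cov_inv (cov_w R)).1 *m
    ((cov_inv (cov_w R)).1 *m 1%:M)))))))) cov_wV_mx mulmx1 !mul_mx2 -mx2_1.
  by congr mx2; ring.
rewrite /rel_wt !evE /quarter_turn /quarter_turnV.
have -> : pi - pi / 2 - pi / 2 = 0 :> R by lra.
have [t0 _] := turn_t_axis (sin0 R); rewrite -[(cov_t R).2.1]/ft in t0.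
rewrite t0; have := turn_bound U (0 + pi / 2).
move: (ft _) => y; have := turn_bound U (y + pi / 2).
move: (ft _) => y'; rewrite [pi *+ 2]mulr2n !ltr_norml => /andP [? ?] /andP [? ?].
by have := pi_gt0 R => ?; apply/andP; split; lra.
Qed.

Lemma ev_rel_stt : ev rel_stt = cov_one R.
Proof.
apply: (cov_one_small (t := 0)); first exact: ev_in_cover.
  rewrite -[LHS]/((cov_s R).1 *m (U *m (U *m ((cov_s R).1 *m (U *m (U *m
    ((cov_s R).1 *m (U *m (U *m ((cov_inv (cov_s R)).1 *m
    ((cov_inv (cov_s R)).1 *m 1%:M)))))))))))
    cov_sV_mx cov_s_mx mulmx1 !mul_mx2 -mx2_1.
  by congr mx2; field.
(* On angles this relator is the conjugate of [rel_wt] by [cov_q], as [s] comes from [w] and [t^2]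
   from [t]. *)
have Er y : quarter_turn (ft (quarter_turn (ft (quarter_turn (ft (quarter_turnV
    (quarter_turnV y))))))) = y.
  by have /(congr1 (fun x : cov R => x.2.1 y)) := ev_rel_wt; rewrite /rel_wt !evE.
have Eq y : ft (ft y) = turn_q (ft (turn_qV y)).
  exact: esym (congr1 (fun x : cov R => x.2.1 y) (cov_qt R)).
have [_ [_ [qK [qK' _]]]] := cov_q_in R.
rewrite -[(cov_q R).2.1]/turn_q -[(cov_q R).2.2]/turn_qV in qK qK'.
rewrite /rel_stt !evE !Eq !qK Er qK' subrr normr0 mulr2n.
by have := pi_gt0 R; lra.
Qed.

Lemma ev_rel_wst : ev rel_wst = cov_one R.
Proof.
(* Starting from pi / 2 every letter maps a coordinate axis to a coordinate axis, so all
   intermediate angles are known exactly: they are 0 or pi / 2. *)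
apply: (cov_one_small (t := pi / 2)); first exact: ev_in_cover.
  rewrite -[LHS]/(W *m (U *m ((cov_inv (cov_w R)).1 *m ((cov_s R).1 *m
    ((cov_inv (cov_t R)).1 *m ((cov_inv (cov_t R)).1 *m ((cov_inv (cov_t R)).1 *m
    ((cov_inv (cov_t R)).1 *m ((cov_inv (cov_s R)).1 *m 1%:M)))))))))
    cov_sV_mx cov_s_mx cov_wV_mx cov_tV_mx mulmx1 !mul_mx2 -mx2_1.
  by congr mx2; field.
have [q1 q1'] := turn_q_axes (or_introl (cos_pihalf R)).
have [q0 q0'] := turn_q_axes (or_intror (sin0 R)).
have [t0 t0'] := turn_t_axis (sin0 R).
rewrite -[(cov_q R).2.1]/turn_q -[(cov_q R).2.2]/turn_qV in q1 q1' q0 q0'.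
rewrite -[(cov_t R).2.1]/ft -[(cov_t R).2.2]/ft' in t0 t0'.
rewrite /rel_wst !evE /quarter_turn /quarter_turnV q1' subrr q0 !t0' q0' add0r q1 subrr t0 add0r.
rewrite subrr normr0 mulr2n.
by have := pi_gt0 R; lra.
Qed.

Lemma ev_gamma_rels r : r \in gamma_rels -> ev r = cov_one R.
Proof.
rewrite !inE => /or3P [] /eqP ->.
- exact: ev_rel_wt.
- exact: ev_rel_stt.
- exact: ev_rel_wst.
Qed.

End CoverRelations.

(** * The presented group as a quotient of words *)

Section WordGroup.
Local Open Scope quotient_scope.

(** The type of words allows indices beyond the three generators. Deleting such letters makes them
    trivial in the quotient, in accordance with the default value [one] in [eval_word]. *)
Definition keep (v : word) : word := [seq ib <- v | (ib.1 < 3)%N].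

Lemma pres_equiv_cat (rels : seq word) a a' b b' :
  pres_equiv rels a a' -> pres_equiv rels b b' -> pres_equiv rels (a ++ b) (a' ++ b').
Proof.
move=> Ha Hb; apply: (rst_trans _ _ _ (a' ++ b)).
  elim: Ha => [c c' H|c|c c' _|c1 c2 c3 _ H1 _]; first last.
  - exact: rst_trans.
  - exact: rst_sym.
  - exact: rst_refl.
  apply: rst_step; case: H => [u v i e|u v r rr]; rewrite -!catA.
    exact: (pres_red _ u (v ++ b)).
  exact: (pres_rel u (v ++ b)).
elim: Hb => [c c' H|c|c c' _|c1 c2 c3 _ H1 _]; first last.
- exact: rst_trans.
- exact: rst_sym.
- exact: rst_refl.
apply: rst_step; case: H => [u v i e|u v r rr]; rewrite !catA.
  exact: (pres_red rels (a' ++ u) v i e).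
by rewrite -(catA _ r v); exact: pres_rel.
Qed.

Definition wequiv (v v' : word) : bool := `[< pres_equiv gamma_rels (keep v) (keep v') >].

Lemma wequiv_refl : reflexive wequiv.
Proof. by move=> v; apply/asboolP/rst_refl. Qed.

Lemma wequiv_sym : symmetric wequiv.
Proof. by move=> v v'; apply/asboolP/asboolP; exact: rst_sym. Qed.

Lemma wequiv_trans : transitive wequiv.
Proof. by move=> v2 v1 v3 /asboolP H1 /asboolP H2; apply/asboolP; exact: rst_trans H1 H2. Qed.

Canonical wequiv_rel := EquivRel wequiv wequiv_refl wequiv_sym wequiv_trans.

Definition pres_group := {eq_quot wequiv_rel}.

HB.instance Definition _ := Choice.on pres_group.

Definition wclass (v : word) : pres_group := \pi_({eq_quot wequiv_rel}) v.

Lemma wclassP v v' : wclass v = wclass v' <-> pres_equiv gamma_rels (keep v) (keep v').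
Proof. by split=> [/eqmodP/asboolP//|H]; apply/eqmodP/asboolP. Qed.

Lemma wclass_repr (x : pres_group) : wclass (repr x) = x.
Proof. exact: reprK. Qed.

Lemma wequiv_repr v : pres_equiv gamma_rels (keep (repr (wclass v))) (keep v).
Proof. by apply/wclassP; rewrite wclass_repr. Qed.

Definition winv (v : word) : word := rev [seq (ib.1, ~~ ib.2) | ib <- v].

Definition pmul (x y : pres_group) := wclass (repr x ++ repr y).
Definition pone := wclass [::].
Definition pinv (x : pres_group) := wclass (winv (repr x)).

Lemma wclass_cat v v' : wclass (v ++ v') = pmul (wclass v) (wclass v').
Proof.
apply/wclassP; rewrite /keep !filter_cat; apply: pres_equiv_cat; apply: rst_sym;
  exact: wequiv_repr.
Qed.

Lemma pmulA : associative pmul.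
Proof.
move=> x y z; rewrite -(wclass_repr x) -(wclass_repr y) -(wclass_repr z).
by rewrite -!wclass_cat catA.
Qed.

Lemma pmul1 : left_id pone pmul.
Proof. by move=> x; rewrite -(wclass_repr x) -wclass_cat. Qed.

Lemma p1mul : right_id pone pmul.
Proof. by move=> x; rewrite -(wclass_repr x) -wclass_cat cats0. Qed.

Lemma pres_red_keep i b : pres_equiv gamma_rels (keep [:: (i, b); (i, ~~ b)]) [::].
Proof.
rewrite /keep /=; case: (i < 3)%N; last by apply: rst_refl.
exact/rst_step/(pres_red gamma_rels [::] [::]).
Qed.

Lemma winv_l v : wclass (winv v ++ v) = pone.
Proof.
elim: v => [|[i b] v IH] //.
rewrite /winv /= rev_cons -/(winv v) -cats1 -catA -(cat1s (i, b) v) !wclass_cat.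
have E : pmul (wclass [:: (i, ~~ b)]) (wclass [:: (i, b)]) = pone.
  rewrite -wclass_cat; apply/wclassP.
  by have := pres_red_keep i (~~ b); rewrite negbK.
by rewrite (pmulA (wclass [:: (i, ~~ b)])) E pmul1 -wclass_cat.
Qed.

Lemma winv_r v : wclass (v ++ winv v) = pone.
Proof.
elim/last_ind: v => [|v [i b] IH] //.
rewrite /winv map_rcons rev_rcons -/(winv v) -cats1 -catA.
rewrite -(cat1s (i, ~~ b) (winv v)) !wclass_cat.
have E : pmul (wclass [:: (i, b)]) (wclass [:: (i, ~~ b)]) = pone.
  by rewrite -wclass_cat; apply/wclassP; exact: pres_red_keep.
by rewrite (pmulA (wclass [:: (i, b)])) E pmul1 -wclass_cat.
Qed.

Lemma pmulV : left_inverse pone pinv pmul.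
Proof. by move=> x; rewrite /pinv -[X in pmul _ X]wclass_repr -wclass_cat winv_l. Qed.

Lemma pmulgV : right_inverse pone pinv pmul.
Proof. by move=> x; rewrite /pinv -[X in pmul X _]wclass_repr -wclass_cat winv_r. Qed.

HB.instance Definition _ := isGroup.Build pres_group pmulA pmul1 p1mul pmulV pmulgV.

End WordGroup.

(** * The relations needed for the word problem *)

Section WordGroupRelations.
Local Open Scope group_scope.

Local Notation W := (wclass [:: (0, false)%N]).
Local Notation T := (wclass [:: (1, false)%N]).
Local Notation S := (wclass [:: (2, false)%N]).

Lemma wclass_cons ib v : wclass (ib :: v) = wclass [:: ib] * wclass v.
Proof. by rewrite -cat1s; exact: wclass_cat. Qed.

Lemma wclass_nil : wclass [::] = 1. Proof. by []. Qed.

Lemma wclassV i : wclass [:: (i, true)] = (wclass [:: (i, false)])^-1.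
Proof.
apply/esym/mulg1_eq; rewrite -wclass_cons.
by apply/wclassP; exact: (pres_red_keep i false).
Qed.

Lemma wclass_prod v : wclass v =
  foldr (fun ib x => (if ib.2 then (wclass [:: (ib.1, false)])^-1
                      else wclass [:: (ib.1, false)]) * x) 1 v.
Proof.
elim: v => [|[i b] v IH] //; rewrite wclass_cons IH /=; congr (_ * _).
by case: b; rewrite ?wclassV.
Qed.

Lemma wclass_big i b : (3 <= i)%N -> wclass [:: (i, b)] = 1.
Proof. by move=> i3; apply/wclassP; rewrite /keep /= ltnNge i3; apply: rst_refl. Qed.

Lemma wclass_rel r : r \in gamma_rels -> wclass r = 1.
Proof.
move=> rr; apply/wclassP.
have -> : keep r = r by move: rr; rewrite !inE => /or3P [] /eqP ->.
by have := pres_rel [::] [::] rr; rewrite /= cats0; exact: rst_step.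
Qed.

Lemma word_wt3 : (W * T) ^+ 3 = W ^+ 2.
Proof.
have := @wclass_rel rel_wt (mem_head _ _); rewrite wclass_prod /= mulg1 !mulgA => E.
apply: divg1_eq; rewrite expg2 invgM -[RHS]E !expgS expg0 mulg1 !mulgA //.
Qed.

Lemma word_st3 : (S * T ^+ 2) ^+ 3 = S ^+ 2.
Proof.
have := @wclass_rel rel_stt; rewrite !inE eqxx orbT => /(_ isT); rewrite wclass_prod /=
    mulg1 !mulgA => E.
apply: divg1_eq; rewrite !expg2 invgM -[RHS]E !expgS expg0 mulg1 !mulgA //.
Qed.

Lemma word_wst : W * T * W^-1 = S * T ^+ 4 * S^-1.
Proof.
have := @wclass_rel rel_wst; rewrite !inE eqxx !orbT => /(_ isT); rewrite wclass_prod /=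
    mulg1 !mulgA => E.
by apply: divg1_eq; rewrite -[RHS]E !invgM !invgK !mulgA.
Qed.

Lemma word_zC (x : pres_group) : commute (W ^+ 2) x.
Proof.
have Cl i : commute (W ^+ 2) (wclass [:: (i, false)]).
  case: i => [|[|[|i]]]; last by rewrite (@wclass_big i.+3) // /commute mulg1 mul1g.
  - by apply: commute_w2 word_wt3 word_st3 word_wst _ _; left.
  - by apply: commute_w2 word_wt3 word_st3 word_wst _ _; right; left.
  - by apply: commute_w2 word_wt3 word_st3 word_wst _ _; right; right.
rewrite -(wclass_repr x); elim: (repr x) => [|[i b] v IH]; first by rewrite /commute mulg1 mul1g.
rewrite (wclass_cons (i, b) v); apply: commuteM => //.
by case: b; rewrite ?wclassV; [apply: commuteV|].
Qed.

Lemma word_wtw : W * T * W = T^-1 * W * T^-1.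
Proof. by have [_ ->] := half_twist word_wt3. Qed.

Lemma word_ut : (S * W^-1) * T = T ^+ 4 * (S * W^-1).
Proof. exact: scaling_translation word_wt3 word_st3 word_wst. Qed.

Lemma word_wu : W * (S * W^-1) = (S * W^-1)^-1 * W.
Proof. exact: rotation_scaling word_wt3 word_st3 word_wst. Qed.

(** The relation [s t^2 s = t^-2 s t^-2], rewritten through [w = s u = u^-1 s]. *)
Lemma word_wttw : W * T ^+ 2 * W =
  (S * W^-1)^-1 * T ^- 2 * (S * W^-1) * W * (T ^- 2 * (S * W^-1)).
Proof.
have E1 : W = S * (S * W^-1).
  have := sqr_s_w word_wt3 word_st3 word_wst; rewrite !expg2 mulgA => ->.
  by rewrite mulgK.
have E2 : W = (S * W^-1)^-1 * S by rewrite invgM invgK mulgVK.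
have [_ + _ _] := half_twist word_st3; move: (T ^+ 2) => T2 E.
rewrite [X in _ * _ * X]E1 {1}E2.
have -> : (S / W)^-1 * S * T2 * (S * (S / W)) = (S / W)^-1 * (S * T2 * S) * (S / W).
  by rewrite !mulgA.
by rewrite E !mulgA !mulgVK.
Qed.

End WordGroupRelations.

(** * The presented group is the preimage of SL_2(Z[1/2]) *)

Section GammaTilde.
Variable R : realType.
Local Open Scope group_scope.

Local Notation W := (wclass [:: (0, false)%N]).
Local Notation T := (wclass [:: (1, false)%N]).
Local Notation S := (wclass [:: (2, false)%N]).
Local Notation Z := (W ^+ 2).
Local Notation U := (S * W^-1).
Local Notation ev := (eval_word (@cov_mul R) (cov_one R) (@cov_inv R) (cov_gens R)).

Lemma ev_keep v : ev (keep v) = ev v.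
Proof.
elim: v => [|[i b] v IH] //=; case: ifP => i3 /=; rewrite IH //.
have -> : nth (cov_one R) (cov_gens R) i = cov_one R by rewrite nth_default // leqNgt i3.
have -> : cov_inv (cov_one R) = cov_one R by rewrite /cov_inv /= invmx1.
by rewrite if_same cov_mul1l.
Qed.

Definition evq (x : pres_group) : cov R := ev (repr x).

Lemma evq_class v : evq (wclass v) = ev v.
Proof.
rewrite /evq -ev_keep -[RHS]ev_keep.
apply: pres_equiv_ev (wequiv_repr v); try exact: ev_gamma_rels.
- exact: cov_mulA.
- exact: cov_mul1l.
- exact: cov_mulV.
- exact: cov_mulVl.
- exact: in_cover_one.
- exact: cov_gens_in.
Qed.

Lemma evqM x y : evq (x * y) = cov_mul (evq x) (evq y).
Proof.
rewrite -(wclass_repr x) -(wclass_repr y) -[_ * _]wclass_cat !evq_class.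
by apply: ev_cat; [exact: cov_mulA|exact: cov_mul1l].
Qed.

Definition phi x := (evq x).1.

Lemma phi_one : phi 1 = 1%:M.
Proof. by rewrite /phi -wclass_nil evq_class. Qed.

Lemma phi_mul x y : phi (x * y) = phi x *m phi y.
Proof. by rewrite /phi evqM. Qed.

Lemma phi_W : phi W = mx2 0 (-1) 1 0.
Proof. by rewrite /phi evq_class /= mulmx1. Qed.

Lemma phi_T : phi T = mx2 1 1 0 1.
Proof. by rewrite /phi evq_class /= mulmx1. Qed.

Lemma phi_U : phi U = mx2 2 0 0 2^-1.
Proof.
rewrite phi_mul -wclassV /phi !evq_class.
rewrite -[X in X *m _]/((cov_s R).1 *m 1%:M) -[X in _ *m X]/((cov_inv (cov_w R)).1 *m 1%:M).
by rewrite !mulmx1 cov_s_mx cov_wV_mx mul_mx2; congr mx2; ring.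
Qed.

Local Notation eucl := (euclidean W T U Z phi).

(** Rotations and triangular elements preserve expansions, and [s = u * w] reduces the remaining
    generator to them. *)
Lemma eucl_all x : eucl x.
Proof.
have bm b g : in_borel T U Z b -> eucl g -> eucl (b * g).
  exact: (@euclidean_bmul R pres_group W T U Z phi word_zC word_ut).
have wm g : eucl g -> eucl (W * g).
  exact: (euclidean_mulw erefl word_zC word_ut word_wu word_wtw word_wttw
            phi_one phi_mul phi_W phi_T phi_U).
have Bu p : in_borel T U Z (zpow U p) by exact: borel_upow word_zC p.
have Bt p : in_borel T U Z (zpow T p) by exact: borel_tpow word_zC word_ut p.
have wVm g : eucl g -> eucl (W^-1 * g).
  move=> Eg; have -> : W^-1 * g = zpow Z (-1) * (W * g).
    by rewrite zpowN zpow1 expg2 invgM !mulgA mulgVK.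
  by apply: bm; [exact: borel_zpow|exact: wm].
have sm g : eucl g -> eucl (S * g).
  move=> Eg; have -> : S * g = zpow U 1 * (W * g) by rewrite zpow1 mulgA mulgVK.
  by apply: bm => //; exact: wm.
have sVm g : eucl g -> eucl (S^-1 * g).
  move=> Eg; have -> : S^-1 * g = W^-1 * (zpow U (-1) * g).
    by rewrite zpowN zpow1 invgM invgK -!mulgA mulKg.
  by apply: wVm; exact: bm.
rewrite -(wclass_repr x) (wclass_prod (repr x)).
elim: (repr x) => [|[i b] v IH] /=; first exact/euclidean_borel/borel1.
case: i => [|[|[|i]]].
- by case: b; [exact: wVm|exact: wm].
- by case: b; [exact: (bm _ _ (Bt (-1)%R))|exact: (bm _ _ (Bt 1%R))].
- by case: b; [exact: sVm|exact: sm].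
- by rewrite (@wclass_big i.+3) // invg1 if_same mul1g.
Qed.

Lemma evq_zpow i y : (evq (zpow Z i)).2.1 y = y + i%:~R * pi.
Proof.
have Ez x y' : (evq (Z * x)).2.1 y' = (evq x).2.1 y' + pi.
  rewrite expg2 -mulgA !evqM !evq_class.
  rewrite -[LHS]/((evq x).2.1 y' + pi / 2 + pi / 2).
  by rewrite -addrA -splitr.
have E1 : (evq 1).2.1 y = y by rewrite -wclass_nil evq_class.
case: i => k.
  elim: k => [|k IH]; first by rewrite E1 mul0r addr0.
  rewrite intS zpowS Ez IH rmorphD /=; ring.
have step j : (evq (zpow Z (1 + j)%R)).2.1 y = (evq (zpow Z j)).2.1 y + pi.
  by rewrite zpowS Ez.
elim: k => [|k IH].
  have := step (-1)%R; rewrite subrr E1 => E; rewrite {2}E mulN1r addrK //.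
have := step (Negz k.+1); have -> : (1 + Negz k.+1)%R = Negz k by lia.
rewrite IH !NegzE -[k.+2]addn1 PoszD opprD rmorphD /= => E.
by apply: (addIr pi); rewrite -E; ring.
Qed.

Lemma evq_in x : in_cover (evq x).
Proof. exact: ev_in_cover. Qed.

Lemma word_equiv v : word_in (size (cov_gens R)) v -> ev v = cov_one R ->
  pres_equiv gamma_rels v [::].
Proof.
move=> Wv Ev.
have kv : keep v = v by apply/all_filterP.
have [i Ei] : central_eq Z (wclass v) 1.
  apply: (euclidean_rigid erefl word_zC word_ut word_wu word_wtw word_wttw
            phi_one phi_mul phi_W phi_T phi_U); [exact: eucl_all|exact: eucl_all|].
  by rewrite phi_one /phi evq_class Ev.
have i0 : i = 0%R.
  have := evq_zpow i 0; rewrite -[zpow _ _]mulg1 -Ei evq_class Ev /= add0r.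
  move/esym/eqP; rewrite mulf_eq0 (gt_eqF (pi_gt0 R)) orbF intr_eq0 => /eqP //.
have /wclassP : wclass v = wclass [::] by rewrite Ei i0 mulg1.
by rewrite kv.
Qed.

Lemma word_surj x : Gamma_tilde x ->
  exists v, word_in (size (cov_gens R)) v /\ ev v = x.
Proof.
move=> [Cx Dx]; have [dx _] := Cx.
have [|g _ Pg] := euclidean_surj (A := x.1) erefl word_zC word_ut phi_one phi_mul phi_W phi_T phi_U.
  by split.
pose d := (x.2.1 0 - (evq g).2.1 0)%R.
(* The square of [z] is trivial on matrices and shifts angles by 2 pi, whence the exponent [2 * k];
   rounding down leaves a difference below 2 pi at the angle 0. *)
pose k := Num.floor (d / (pi *+ 2)).
pose h := zpow Z (2 * k)%R * g.
exists (keep (repr h)); split; first by rewrite /word_in /keep filter_all.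
have p2 : (0 < pi *+ 2 :> R)%R by rewrite mulr2n addr_gt0 ?pi_gt0.
rewrite ev_keep -/(evq h); apply: (cov_ext (t := 0)) => //; first exact: evq_in.
  rewrite /h evqM /= -[(evq g).1]/(phi g) Pg -[(evq _).1]/(phi _).
  rewrite (phi_z erefl phi_one phi_mul phi_W) -exprz_exp.
  have -> : ((-1) ^ 2 = 1 :> R)%R by rewrite -[LHS]/((-1) ^+ 2)%R sqrrN expr1n.
  by rewrite exp1rz mx2_1 mul1mx.
rewrite /h evqM -[X in `|X - _|%R]/((evq (zpow Z (2 * k)%R)).2.1 ((evq g).2.1 0)) evq_zpow.
have [f1 f2] : (k%:~R <= d / (pi *+ 2) /\ d / (pi *+ 2) < k%:~R + 1)%R.
  by split; [exact: floor_le|have := floorD1_gt (d / (pi *+ 2)); rewrite rmorphD].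
rewrite ler_pdivlMr // in f1; rewrite ltr_pdivrMr // in f2.
rewrite intrM /= ltr_norml.
move: f1 f2; rewrite /d mulrDl mul1r mulr2n mulrDr => f1 f2.
by apply/andP; split; lra.
Qed.

End GammaTilde.

(** * Finite presentation and homology *)

Section GammaHomology.
Variable R : realType.
Local Notation mul := (@cov_mul R).
Local Notation one := (cov_one R).
Local Notation inv := (@cov_inv R).
Local Notation Gam := (@Gamma_tilde R).
Local Notation gens := (cov_gens R).
Local Notation ev := (eval_word mul one inv gens).

Lemma Gamma_mulV x : Gam x -> mul x (inv x) = one.
Proof. by case=> Cx _; exact: cov_mulV. Qed.

Lemma Gamma_mulVl x : Gam x -> mul (inv x) x = one.
Proof. by case=> Cx _; exact: cov_mulVl. Qed.

Lemma Gamma_finitely_presented : finitely_presented mul one inv Gam.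
Proof.
exists gens, gamma_rels; split; first exact: cov_gens_Gamma.
split=> //; split; first exact: word_surj.
move=> v Wv; split; first exact: word_equiv.
by apply: (pres_equiv_ev (@cov_mulA R) (@cov_mul1l R) Gamma_mulV Gamma_mulVl (Gamma_one R)
  (@cov_gens_Gamma R)); exact: ev_gamma_rels.
Qed.

Lemma Gamma_H1_finite : H1_finite mul Gam int.
Proof.
pose B := bound1 mul Gam (K := int).
have Bw v : B (fun x => basis int [:: ev v] x -
    letter_sum (fun i => basis int [:: nth one gens i]) v x).
  exact: (bound1_word int (@cov_mul1l R) Gamma_mulV (Gamma_one R)
    (@Gamma_mul R) (@Gamma_inv R) (@cov_gens_Gamma R)).
have B1 : B (basis int [:: one]).
  by apply: bound1_ext (Bw [::]) => x; rewrite /letter_sum big_nil subr0.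
have Br r : r \in gamma_rels -> B (letter_sum (fun i => basis int [:: nth one gens i]) r).
  move=> rr; apply: bound1_ext (bound1_sub B1 (Bw r)) => x.
  by rewrite (ev_gamma_rels R rr); ring.
(* The exponent sums of (w, t, s) in the three relators are (1, 3, 0), (0, 6, 1) and (0, -3, 0). *)
have r1 : B (fun x => basis int [:: cov_w R] x + 3 * basis int [:: cov_t R] x).
  apply: bound1_ext (Br rel_wt _) => [x|]; last by rewrite !inE eqxx.
  by rewrite /letter_sum !big_cons big_nil /=; ring.
have r2 : B (fun x => basis int [:: cov_s R] x + 6 * basis int [:: cov_t R] x).
  apply: bound1_ext (Br rel_stt _) => [x|]; last by rewrite !inE eqxx orbT.
  by rewrite /letter_sum !big_cons big_nil /=; ring.
have r3 : B (fun x => 3%:Z * basis int [:: cov_t R] x).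
  apply: bound1_ext (bound1_scale (-1) (Br rel_wst _)) => [x|]; last by rewrite !inE eqxx !orbT.
  by rewrite /letter_sum !big_cons big_nil /=; ring.
have Bi i : exists k : int, B (fun x => basis int [:: nth one gens i] x - k * basis int [::
    cov_t R] x).
  case: i => [|[|[|i]]] /=.
  - by exists (-3); apply: bound1_ext r1 => x; ring.
  - by exists 1; apply: bound1_ext (bound1_0 _ _ _) => x; ring.
  - by exists (-6); apply: bound1_ext r2 => x; ring.
  - by exists 0; rewrite nth_nil; apply: bound1_ext B1 => x; ring.
apply: (H1_finite_cyclic (t := cov_t R) (M := 3)) => //.
  by apply: cov_gens_Gamma; right; left.
move=> g /word_surj [v [_ <-]].
have [k Hk] : exists k : int, B (fun x =>
    letter_sum (fun i => basis int [:: nth one gens i]) v x - k * basis int [:: cov_t R] x).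
  elim: v => [|[i b] v [k Hk]].
    by exists 0; apply: bound1_ext (bound1_0 _ _ _) => x; rewrite /letter_sum big_nil; ring.
  have [k' Hk'] := Bi i; exists ((-1) ^+ b * k' + k).
  apply: bound1_ext (bound1_add (bound1_scale ((-1) ^+ b) Hk') Hk) => x.
  by rewrite /letter_sum big_cons /=; case: b; ring.
by exists k; apply: bound1_ext (bound1_add (Bw v) Hk) => x; ring.
Qed.

Lemma Gamma_H2_zero : H2_zero mul Gam R.
Proof.
have s1 (l : nat -> seq (cov R) -> R) x : letter_sum l rel_wt x = l 0%N x + 3 * l 1%N x.
  by rewrite /letter_sum !big_cons big_nil /=; ring.
have s2 (l : nat -> seq (cov R) -> R) x : letter_sum l rel_stt x = l 2%N x + 6 * l 1%N x.
  by rewrite /letter_sum !big_cons big_nil /=; ring.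
have s3 (l : nat -> seq (cov R) -> R) x : letter_sum l rel_wst x = - (3 * l 1%N x).
  by rewrite /letter_sum !big_cons big_nil /=; ring.
pose L0 := lift_coord mul one inv gens (K := R) (fun _ _ => 0).
(* The third relator involves only the correction of [t] and determines it after a division by 3,
   possible over the reals; the other two relators then give the corrections of [w] and [s]. *)
pose lt x := L0 rel_wst x / 3.
pose l i x : R := match i with
  | 0%N => - L0 rel_wt x - 3 * lt x
  | 1%N => lt x
  | 2%N => - L0 rel_stt x - 6 * lt x
  | _ => 0 end.
have Hr r : r \in gamma_rels -> bound2 mul Gam (lift_coord mul one inv gens l r).
  move=> rr; apply: bound2_ext (bound2_0 _ _ _) => x.
  rewrite lift_coord_shift -/L0; move: rr; rewrite !inE => /or3P [] /eqP ->.
  - by rewrite s1 /l; ring.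
  - by rewrite s2 /l; ring.
  - by rewrite s3 /l /lt; field.
have [F HF] := cocycle_splits (@cov_mulA R) (@cov_mul1l R) (@cov_mul1r R) Gamma_mulV Gamma_mulVl
  (Gamma_one R) (@Gamma_mul R) (@Gamma_inv R) (@cov_gens_Gamma R)
  (@ev_gamma_rels R) Hr (@word_surj R) (@word_equiv R).
exact: H2_zero_splitting HF.
Qed.

End GammaHomology.

Theorem theorem1p5 (R : realType) :
  finitely_presented (@cov_mul R) (@cov_one R) (@cov_inv R) (@Gamma_tilde R) /\
  H1_finite (@cov_mul R) (@Gamma_tilde R) int /\
  H2_zero (@cov_mul R) (@Gamma_tilde R) R.
Proof.
split; first exact: Gamma_finitely_presented.
by split; [exact: Gamma_H1_finite|exact: Gamma_H2_zero].
Qed.
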